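(* Let $\mathrm{d}\mu(\theta;t)=\omega(\theta;t)\,\mathrm{d}\mu(\theta)$ be a finite nonnegative measure with infinite support on the unit circle parametrized by $z=e^{i\theta}$ $(\theta\in[\theta_0,\theta_0+2\pi))$ and depending on a parameter $t$ varying in a real open interval containing $t_0$. Suppose that for almost all $\theta\in[\theta_0,\theta_0+2\pi)$, $\omega(\theta;t)$ is finite and admits partial derivative with respect to $t$. Suppose furthermore that there exists a $\mu$-integrable function $\alpha$ such that $$\left|\frac{\partial\omega}{\partial t}(\theta;t)\right|\le\alpha(\theta)$$ almost everywhere in $[\theta_0,\theta_0+2\pi)$. Let $P(z;t)$ be a nonconstant monic POPUC associated with $\mathrm{d}\mu(\theta;t)$, and assume that $P(\zeta_0;t_0)=0$. Under these hypotheses there exist $\epsilon>0$ and $\delta>0$ such that $C_\delta(\zeta_0)\times I_\epsilon(t_0)$ is in the neighbourhood where $P$ is defined, and there exists $\zeta:I_\epsilon(t_0)\to C_\delta(\zeta_0)$ such that $P(\zeta(t);t)=0$ and, for each $t\in I_\epsilon(t_0)$, $\zeta(t)$ is the unique solution of this equation lying in $C_\delta(\zeta_0)$; moreover, $\zeta$ possesses continuous derivatives on $I_\epsilon(t_0)$. Let $\epsilon$, $\delta$ and $\zeta$ be as just described. Assume also that $P(e^{i\theta_0};t)=0$ for each $t\in I_\epsilon(t_0)$. Suppose that $\omega(\theta;t)$ is positive and continuous for each $\theta\in[\theta_0,\theta_0+2\pi)$ and $t\in I_\epsilon(t_0)$. Suppose furthermore that the partial derivative of $\omega(\theta;t)$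 with respect to $t$ is continuous for each $\theta\in[\theta_0,\theta_0+2\pi)$ and $t\in I_\epsilon(t_0)$. Then $\zeta(t)$ moves strictly counterclockwise along $\mathbb{S}^1$ as $t$ increases on $I_\epsilon(t_0)$, provided that $$\frac{1}{\omega(\theta;t)}\frac{\partial\omega}{\partial t}(\theta;t)$$ is a strictly increasing function of $\theta$ on $(\theta_0,\theta_0+2\pi)$.
   Context: Notation: $\mathbb{S}^1$ is the unit circle in $\mathbb{C}$ centered at the origin; $\mathbb{D}_r(c)$ is the open disk of radius $r>0$ with center $c$; $C_r(c)=\mathbb{D}_r(c)\cap\mathbb{S}^1$; $I_r(c)=\mathbb{D}_r(c)\cap\mathbb{R}$. For a finite nonnegative measure $\mathrm{d}\nu(\theta)$ with infinite support on the unit circle parametrized by $z=e^{i\theta}$, $(Q_n)_{n\ge0}$ denotes the unique sequence of monic orthogonal polynomials on the unit circle associated with $\mathrm{d}\nu$, that is, $Q_n(z)=z^n+\cdots$ with $\int Q_n(e^{i\theta})\overline{Q_m(e^{i\theta})}\,\mathrm{d}\nu(\theta)=0$ for $n\ne m$ and $\int|Q_n(e^{i\theta})|^2\,\mathrm{d}\nu(\theta)\neq0$; and $Q_n^*(z)=z^n\overline{Q_n(1/\overline{z})}$. For $n\in\{1,2,\dots\}$ and $b\in\mathbb{S}^1$, the monic paraorthogonal polynomial on the unit circle (POPUC) of degree $n$ associated with $\mathrm{d}\nu$ and $b$ is $$P_n(z;b;\mathrm{d}\nu)=zQ_{n-1}(z)-\overline{b}\,Q_{n-1}^*(z).$$ All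 zeros of a POPUC are simple and lie on $\mathbb{S}^1$.
   Formalization: For the existence of ζ with continuous derivatives, b is assumed continuously differentiable in t and ∂ω/∂t continuous in t for almost all θ; for the monotonicity, ζ₀ ≠ e^{iθ₀} is assumed. Without these the claims fail (e.g. ω=1+t²sin(1/t)cosθ; ζ constant if ζ₀=e^{iθ₀}). *)

(* Defs.v *)
From HB Require Import structures.
From mathcomp Require Import all_boot all_order all_algebra.
From mathcomp Require Import all_classical all_reals all_analysis.
From mathcomp Require Import measurable_realfun complex.
Set Implicit Arguments.
Unset Strict Implicit.
Unset Printing Implicit Defensive.
Import Order.TTheory GRing.Theory Num.Theory.
Import numFieldNormedType.Exports.
Local Open Scope classical_set_scope.
Local Open Scope complex_scope.
Local Open Scope ring_scope.

(* Measures on the unit circle are Borel measures on the real line, carried by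
   a half-open interval [theta0, theta0 + 2 pi) that parametrizes the circle
   through theta |-> cis theta. *)

Definition cis (R : realType) (theta : R) : R[i] := cos theta +i* sin theta.

Definition period (R : realType) (theta0 : R) : set R :=
  `[theta0, theta0 + 2 * pi[%classic.

(* C_r(c): the part of the unit circle inside the open disk D_r(c). *)
Definition circ (R : realType) (c : R[i]) (r : R) : set R[i] :=
  [set z | `|z| = 1 /\ `|z - c| < r%:C].

Definition Cintegral (R : realType) (nu : {measure set R -> \bar R})
    (f : R -> R[i]) : R[i] :=
  Rintegral nu setT (fun theta => complex.Re (f theta)) +i*
  Rintegral nu setT (fun theta => complex.Im (f theta)).

Definition circle_support (R : realType) (nu : {measure set R -> \bar R}) :
    set R[i] :=
  [set z | `|z| = 1 /\
    forall r : R, 0 < r ->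
      (0 < nu [set theta | (`|cis theta - z| < r%:C)%R])%E].

Definition has_density (R : realType) (D : set R)
    (nu mu : {measure set R -> \bar R}) (w : R -> \bar R) : Prop :=
  [/\ measurable_fun D w,
      {ae mu, forall theta, D theta -> (0 <= w theta)%E} &
      forall A, measurable A ->
        nu A = (\int[mu]_(theta in A `&` D) w theta)%E].

Definition opuc (R : realType) (nu : {measure set R -> \bar R})
    (Q : nat -> {poly R[i]}) : Prop :=
  [/\ forall n, Q n \is monic /\ size (Q n) = n.+1,
      forall n m, n != m ->
        Cintegral nu (fun theta => (Q n).[cis theta] * ((Q m).[cis theta])^*)
        = 0 &
      forall n, Cintegral nu (fun theta => `|(Q n).[cis theta]| ^+ 2) != 0].

(* The polynomial z^n * conj (Q (1 / conj z)), for Q of degree at most n; see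
   [horner_revpoly]. *)
Definition revpoly (R : realType) (n : nat) (Q : {poly R[i]}) : {poly R[i]} :=
  \poly_(k < n.+1) (Q`_(n - k))^*.

Lemma horner_revpoly (R : realType) (n : nat) (Q : {poly R[i]}) (z : R[i]) :
  (size Q <= n.+1)%N -> z != 0 ->
  (revpoly n Q).[z] = z ^+ n * (Q.[(z^*)^-1])^*.
Proof.
move=> sQ z0; rewrite (horner_coef_wide _ sQ) horner_poly rmorph_sum mulr_sumr.
rewrite (reindex_inj rev_ord_inj) /=; apply: eq_bigr => -[k /= kn] _.
rewrite !subSS subKn // rmorphM rmorphXn /= mulrCA; congr (_ * _).
have -> : ((z^*)^-1)^* = z^-1 by rewrite (fmorphV conjc (z^*)) /= conjcK.
by rewrite exprVn expfB_cond ?(negbTE z0).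
Qed.

(* [P] is the monic POPUC P_n(z; b; dnu).  Use with 0 < n. *)
Definition popuc (R : realType) (nu : {measure set R -> \bar R}) (n : nat)
    (b : R[i]) (P : {poly R[i]}) : Prop :=
  `|b| = 1 /\
  exists2 Q : nat -> {poly R[i]}, opuc nu Q &
    P = 'X * Q n.-1 - (b^*)%:P * revpoly n.-1 (Q n.-1).

(* The densities are extended-real valued, since they may be infinite on a
   negligible set; their partial derivatives in t are those of [fine]. *)
Definition derivable_t (R : realType) (w : R -> R -> \bar R) (theta t : R) :
    Prop := derivable (fun s => fine (w theta s)) t 1.

Definition d_t (R : realType) (w : R -> R -> \bar R) (theta t : R) : R :=
  derive1 (fun s => fine (w theta s)) t.

Definition C1_on (R : realType) (U : set R) (f : R -> R) : Prop :=
  forall t, U t -> derivable f t 1 /\ {for t, continuous (derive1 f)}.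

Definition C1c_on (R : realType) (U : set R) (f : R -> R[i]) : Prop :=
  C1_on U (fun t => complex.Re (f t)) /\ C1_on U (fun t => complex.Im (f t)).

Definition zero_branch (R : realType) (P : R -> {poly R[i]}) (J : set R)
    (zeta0 : R[i]) (t0 eps delta : R) (zeta : R -> R[i]) : Prop :=
  [/\ 0 < eps, 0 < delta, ball t0 eps `<=` J,
      forall t, ball t0 eps t ->
        [/\ circ zeta0 delta (zeta t), root (P t) (zeta t) &
            forall z, circ zeta0 delta z -> root (P t) z -> z = zeta t] &
      C1c_on (ball t0 eps) zeta].

(* A continuous argument on an interval is unique up to an additive constant,
   so the choice of [phi] is immaterial. *)
Definition strictly_counterclockwise (R : realType) (U : set R)
    (zeta : R -> R[i]) : Prop :=
  exists phi : R -> R,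
    [/\ {within U, continuous phi},
        forall t, U t -> zeta t = cis (phi t) &
        forall s t, U s -> U t -> s < t -> phi s < phi t].

(* Main.v *)
Require Import Defs.
From HB Require Import structures.
From mathcomp Require Import all_boot all_order all_algebra.
From mathcomp Require Import all_classical all_reals all_analysis.
From mathcomp Require Import measurable_realfun complex.
From mathcomp Require Import ring lra.
Set Implicit Arguments.
Unset Strict Implicit.
Unset Printing Implicit Defensive.
Import Order.TTheory GRing.Theory Num.Theory.
Import numFieldNormedType.Exports.
Local Open Scope classical_set_scope.
Local Open Scope complex_scope.
Local Open Scope ring_scope.

                                                     

(** Let [E t] be integration against [mut t], and [ip (E t)] the sesquilinear form it induces on
    polynomials restricted to the circle. The key fact is [popuc_orth]: the POPUC [P t], of degree
    [m.+1], is orthogonal to ['X * G] whenever [G] has size at most [m]. Hence the zeros are simple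
    and lie on the circle.

    Existence of the branch: dominated differentiation makes each [E t f] continuously
    differentiable in [t], and Gram-Schmidt transfers this to the coefficients of the orthogonal
    polynomials, then to [P t] once [b] is regular ([cC1_popuc]). A simple zero can then be
    continued as in the implicit function theorem, by means of divided differences
    ([exists_zero_branch]). When [cis theta0] is a permanent zero, it determines [b], whose
    regularity is then a consequence ([cC1_popuc_parameter]).

    Monotonicity: put [a = cis theta0], fix [s], write [zeta = cis phi], and let [T] be [P] divided
    by its factors at [a] and [zeta]. Differentiating one pairing in two ways yields the velocity of
    the zero in terms of the derivative of the functional [E]; the derivative of [T] drops out by
    orthogonality ([zero_velocity]). Passing to arguments, [phi' * D = 8 * sin ((phi - theta0) / 2)
    * N], where [D] is the squared norm of [('X - a%:P) * T] and [N] is the integral of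
    [k * d_t omega], with [k] the [sine_kernel], equal to [sin ((theta - theta0) / 2) * sin ((theta
    - phi) / 2)] times the squared modulus of [T].

    Orthogonality of [P] also says that [k * omega] has integral zero. With [g] the quotient of
    [d_t omega] by [omega], one may therefore subtract [g phi * omega] and read [N] as the integral
    of [k * omega * (g theta - g phi)]. The first sine is positive inside the period; the second has
    the sign of [theta - phi], and so does [g theta - g phi]. The integrand is thus nonnegative, and
    it is not almost everywhere zero, since otherwise [P] would have norm zero ([sine_kernel_sign],
    [d_functional_gt0]). So [phi' > 0]. *)

(** * Limits of complex-valued functions, taken componentwise *)

Section ComplexLimits.
Context {R : realType} {T : Type} {F : set_system T} {FF : Filter F}.
Implicit Types (f g : T -> R[i]) (k l : R[i]).

(** The filter is arbitrary because the notion is used both at a real parameter and along the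
    product filter that lets a parameter and two complex points vary together. *)
Definition ccvg (F : set_system T) f l :=
  (fun x => complex.Re (f x)) @ F --> complex.Re l /\
  (fun x => complex.Im (f x)) @ F --> complex.Im l.

Lemma ccvg_cst k : ccvg F (fun=> k) k.
Proof. by split; apply: cvg_cst. Qed.

Lemma ccvgD f g k l : ccvg F f k -> ccvg F g l ->
  ccvg F (fun x => f x + g x) (k + l).
Proof.
move=> [f1 f2] [g1 g2]; split; rewrite ?raddfD /=.
- under [X in X @ _ --> _]eq_fun do rewrite raddfD; exact: cvgD.
- under [X in X @ _ --> _]eq_fun do rewrite raddfD; exact: cvgD.
Qed.

Lemma ReD (x y : R[i]) : complex.Re (x + y) = complex.Re x + complex.Re y.
Proof. by case: x; case: y. Qed.

Lemma ImD (x y : R[i]) : complex.Im (x + y) = complex.Im x + complex.Im y.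
Proof. by case: x; case: y. Qed.

Lemma ReB (x y : R[i]) : complex.Re (x - y) = complex.Re x - complex.Re y.
Proof. by case: x; case: y. Qed.

Lemma ImB (x y : R[i]) : complex.Im (x - y) = complex.Im x - complex.Im y.
Proof. by case: x; case: y. Qed.

Lemma ReM (x y : R[i]) : complex.Re (x * y) =
  complex.Re x * complex.Re y - complex.Im x * complex.Im y.
Proof. by case: x; case: y. Qed.

Lemma ImM (x y : R[i]) : complex.Im (x * y) =
  complex.Re x * complex.Im y + complex.Im x * complex.Re y.
Proof. by case: x; case: y. Qed.

Lemma ccvgM f g k l : ccvg F f k -> ccvg F g l ->
  ccvg F (fun x => f x * g x) (k * l).
Proof.
move=> [f1 f2] [g1 g2]; split; rewrite ?ReM ?ImM.
- under [X in X @ _ --> _]eq_fun do rewrite ReM.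
  by apply: cvgB; apply: cvgM.
- under [X in X @ _ --> _]eq_fun do rewrite ImM.
  by apply: cvgD; apply: cvgM.
Qed.

Lemma ccvgJ f l : ccvg F f l -> ccvg F (fun x => (f x)^*) l^*.
Proof.
have Rc (z : R[i]) : complex.Re z^* = complex.Re z by case: z.
have Ic (z : R[i]) : complex.Im z^* = - complex.Im z by case: z.
move=> [f1 f2]; split; rewrite ?Rc ?Ic.
- by under [X in X @ _ --> _]eq_fun do rewrite Rc.
- under [X in X @ _ --> _]eq_fun do rewrite Ic.
  exact: cvgN.
Qed.

Lemma ccvgN f l : ccvg F f l -> ccvg F (fun x => - f x) (- l).
Proof.
move=> [f1 f2]; split; rewrite raddfN /=.
- by under [X in X @ _ --> _]eq_fun do rewrite raddfN; exact: cvgN.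
- by under [X in X @ _ --> _]eq_fun do rewrite raddfN; exact: cvgN.
Qed.

Lemma ccvg_sum (I : Type) (r : seq I) (f : I -> T -> R[i]) (l : I -> R[i]) :
  (forall i, ccvg F (f i) (l i)) ->
  ccvg F (fun x => \sum_(i <- r) f i x) (\sum_(i <- r) l i).
Proof.
move=> fl; elim: r => [|i r IH].
  by under [X in ccvg _ X _]eq_fun do rewrite big_nil; rewrite big_nil;
    apply: ccvg_cst.
under [X in ccvg _ X _]eq_fun do rewrite big_cons; rewrite big_cons.
exact: ccvgD.
Qed.

Lemma ccvgX f l n : ccvg F f l -> ccvg F (fun x => f x ^+ n) (l ^+ n).
Proof.
move=> fl; elim: n => [|n IH].
  by under [X in ccvg _ X _]eq_fun do rewrite expr0; apply: ccvg_cst.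
under [X in ccvg _ X _]eq_fun do rewrite exprS; rewrite exprS.
exact: ccvgM.
Qed.

Lemma normsq_neq0 (z : R[i]) :
  (complex.Re z ^+ 2 + complex.Im z ^+ 2 != 0) = (z != 0).
Proof.
by rewrite eq_complex /= paddr_eq0 ?sqr_ge0 // !sqrf_eq0.
Qed.

Lemma ccvgV f l : l != 0 -> ccvg F f l -> ccvg F (fun x => (f x)^-1) l^-1.
Proof.
move=> l0 [f1 f2].
have n0 : complex.Re l ^+ 2 + complex.Im l ^+ 2 != 0 by rewrite normsq_neq0.
have RV (z : R[i]) : complex.Re z^-1 =
  complex.Re z * (complex.Re z ^+ 2 + complex.Im z ^+ 2)^-1 by case: z.
have IV (z : R[i]) : complex.Im z^-1 =
  - complex.Im z * (complex.Re z ^+ 2 + complex.Im z ^+ 2)^-1.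
  by case: z => a b /=; rewrite mulNr.
have n1 : (fun x => complex.Re (f x) ^+ 2 + complex.Im (f x) ^+ 2) @ F -->
   complex.Re l ^+ 2 + complex.Im l ^+ 2.
  by apply: cvgD; rewrite expr2; under [X in X @ _ --> _]eq_fun do
    rewrite expr2; apply: cvgM.
split; rewrite ?RV ?IV.
- under [X in X @ _ --> _]eq_fun do rewrite RV.
  by apply: cvgM => //; apply: cvgV.
- under [X in X @ _ --> _]eq_fun do rewrite IV.
  by apply: cvgM; [apply: cvgN|apply: cvgV].
Qed.

Lemma ccvg_neq0 f l : l != 0 -> ccvg F f l -> \forall x \near F, f x != 0.
Proof.
move=> l0 [f1 f2]; have : (complex.Re l != 0) || (complex.Im l != 0).
  by rewrite -negb_and -(eq_complex l 0).
case/orP => h.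
- have : \forall x \near F, complex.Re (f x) != 0 by apply: cvgr_neq0 f1 h.
  by apply: filterS => x; apply: contraNneq => ->.
- have : \forall x \near F, complex.Im (f x) != 0 by apply: cvgr_neq0 f2 h.
  by apply: filterS => x; apply: contraNneq => ->.
Qed.

Lemma normc_le_ReIm (z : R[i]) :
  `|z| <= (`|complex.Re z| + `|complex.Im z|)%:C.
Proof.
rewrite {1}(complexE z) (le_trans (ler_normD _ _)) // raddfD /= lerD //.
  by rewrite normc_def /= expr0n /= addr0 sqrtr_sqr.
by rewrite normrM !normc_def /= !expr0n /= !addr0 add0r expr1n sqrtr1 mul1r
   sqrtr_sqr.
Qed.

Lemma ccvg_norm_lt f l (e : R) : 0 < e -> ccvg F f l ->
  \forall x \near F, `|f x - l| < e%:C.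
Proof.
move=> e0 [f1 f2].
have e2 : 0 < e / 2 by rewrite divr_gt0.
move/cvgrPdist_lt : f1 => /(_ _ e2) n1.
move/cvgrPdist_lt : f2 => /(_ _ e2) n2.
near=> x.
apply: le_lt_trans (normc_le_ReIm _) _.
rewrite ltcR [e]splitr ltrD // !raddfB /= distrC.
- by near: x.
- by near: x.
Unshelve. all: by end_near.
Qed.

End ComplexLimits.

(** * Derivatives of complex-valued functions of a real variable *)

Section ComplexDerivatives.
Variable R : realType.
Implicit Types (f g : R -> R[i]) (s t : R) (k l : R[i]) (U : set R).

Definition cderiv f t l :=
  is_derive t (1 : R) (fun s => complex.Re (f s)) (complex.Re l) /\
  is_derive t (1 : R) (fun s => complex.Im (f s)) (complex.Im l).

Lemma cderiv_cst k t : cderiv (fun=> k) t 0.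
Proof. by split; apply: is_derive_cst. Qed.

Lemma cderivD f g t k l : cderiv f t k -> cderiv g t l ->
  cderiv (fun x => f x + g x) t (k + l).
Proof.
move=> [f1 f2] [g1 g2]; split; rewrite ?raddfD /=.
- under [X in is_derive _ _ X _]eq_fun do rewrite raddfD; exact: is_deriveD.
- under [X in is_derive _ _ X _]eq_fun do rewrite raddfD; exact: is_deriveD.
Qed.

Lemma cderivM f g t k l : cderiv f t k -> cderiv g t l ->
  cderiv (fun x => f x * g x) t (k * g t + f t * l).
Proof.
move=> [f1 f2] [g1 g2]; split.
- under [X in is_derive _ _ X _]eq_fun do rewrite ReM.
  have d1 := is_deriveM f1 g1; have d2 := is_deriveM f2 g2.
  apply: (is_derive_eq (is_deriveB d1 d2)).
  by rewrite ReD !ReM; rewrite /GRing.scale /=; ring.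
- under [X in is_derive _ _ X _]eq_fun do rewrite ImM.
  have d1 := is_deriveM f1 g2; have d2 := is_deriveM f2 g1.
  apply: (is_derive_eq (is_deriveD d1 d2)).
  by rewrite ImD !ImM; rewrite /GRing.scale /=; ring.
Qed.

Lemma cderivJ f t l : cderiv f t l -> cderiv (fun x => (f x)^*) t l^*.
Proof.
have Rc (z : R[i]) : complex.Re z^* = complex.Re z by case: z.
have Ic (z : R[i]) : complex.Im z^* = - complex.Im z by case: z.
move=> [f1 f2]; split; rewrite ?Rc ?Ic.
- by under [X in is_derive _ _ X _]eq_fun do rewrite Rc.
- under [X in is_derive _ _ X _]eq_fun do rewrite Ic.
  exact: is_deriveN.
Qed.

Lemma cderiv_sum (I : Type) (r : seq I) (f : I -> R -> R[i]) (l : I -> R[i]) t :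
  (forall i, cderiv (f i) t (l i)) ->
  cderiv (fun x => \sum_(i <- r) f i x) t (\sum_(i <- r) l i).
Proof.
move=> fl; elim: r => [|i r IH].
  by under [X in cderiv X _ _]eq_fun do rewrite big_nil; rewrite big_nil;
    apply: cderiv_cst.
under [X in cderiv X _ _]eq_fun do rewrite big_cons; rewrite big_cons.
exact: cderivD.
Qed.

Lemma cderiv_unique f t k l : cderiv f t k -> cderiv f t l -> k = l.
Proof.
move=> [f1 f2] [g1 g2]; apply/eqP; rewrite eq_complex; apply/andP; split.
- by apply/eqP; rewrite -(derive_val (is_derive := f1)) (derive_val (is_derive := g1)).
- by apply/eqP; rewrite -(derive_val (is_derive := f2)) (derive_val (is_derive := g2)).
Qed.

                                                                          
                                           
(** Carathéodory's form: the difference quotient, completed at [t] by the derivative, is a single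
    function continuous at [t]. Quotients and implicit equations can then be treated by limits of
    complex factors, without splitting into real and imaginary parts. *)
Lemma cderiv_caratheodory f t l :
  cderiv f t l <->
  exists q : R -> R[i], [/\ forall s, f s - f t = (s - t)%:C * q s,
    ccvg (nbhs t) q (q t) & q t = l].
Proof.
split.
- move=> [/is_derive1_caratheodory[g [g1 g2 g3]]
          /is_derive1_caratheodory[h [h1 h2 h3]]].
  exists (fun s => g s +i* h s); split => //.
  + move=> s; apply/eqP; rewrite eq_complex ReM ImM /= !mul0r subr0 addr0.
    by rewrite !raddfB /= g1 h1 ![(s - t) * _]mulrC !eqxx.
  + by rewrite g3 h3; case: l {g3 h3}.
- move=> [q [q1 [q2 q3] <-]]; split; apply/is_derive1_caratheodory.
  + exists (fun s => complex.Re (q s)); split => // s.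
    by rewrite -raddfB /= q1 ReM /= mul0r subr0 mulrC.
  + exists (fun s => complex.Im (q s)); split => // s.
    by rewrite -raddfB /= q1 ImM /= mul0r addr0 mulrC.
Qed.

Lemma cderiv_ccvg f t l : cderiv f t l -> ccvg (nbhs t) f (f t).
Proof.
move=> /cderiv_caratheodory [q [q1 q2 q3]].
have -> : f = fun s => f t + (s - t)%:C * q s.
  by apply: funext => s; rewrite -q1 addrC subrK.
rewrite subrr; apply: ccvgD; first exact: ccvg_cst.
apply: ccvgM => //; split => /=; last exact: cvg_cst.
rewrite -(subrr t); apply: cvgB; [exact: cvg_id | exact: cvg_cst].
Qed.

Lemma cderivV f t l : f t != 0 -> cderiv f t l ->
  cderiv (fun x => (f x)^-1) t (- l / (f t) ^+ 2).
Proof.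
move=> f0 dl; have cf := cderiv_ccvg dl.
move: dl => /cderiv_caratheodory [q [q1 q2 q3]].
pose p s := if s == t then - l / (f t) ^+ 2
            else ((f s)^-1 - (f t)^-1) / (s - t)%:C.
apply/cderiv_caratheodory; exists p; split; last by rewrite /p eqxx.
  move=> s; rewrite /p; case: eqP => [->|/eqP st]; first by rewrite !subrr mul0r.
  by rewrite mulrC divfK // eq_complex /= eqxx andbT subr_eq0.
rewrite {2}/p eqxx -q3 mulNr.
have : ccvg (nbhs t) (fun s => - (q s / (f s * f t))) (- (q t / (f t) ^+ 2)).
  apply: ccvgN; apply: ccvgM => //; rewrite expr2; apply: ccvgV.
    by rewrite mulf_neq0.
  by apply: ccvgM => //; apply: ccvg_cst.
have f0s : \forall s \near t, f s != 0 := ccvg_neq0 f0 cf.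
(* [f] is known to be nonzero only near [t], so the completed quotient [p] agrees with the explicit
   formula only locally; at [s = t] both equal [- l / (f t) ^+ 2]. *)
have pE : \forall s \near t, - (q s / (f s * f t)) = p s.
  near=> s; have fs0 : f s != 0 by near: s; exact: f0s.
  rewrite /p; case: eqP => [->|/eqP st].
    by rewrite -q3 expr2 mulNr.
  have st0 : (s - t)%:C != 0 by rewrite eq_complex /= eqxx andbT subr_eq0.
  have -> : (f s)^-1 - (f t)^-1 = - (f s - f t) / (f s * f t).
    by field; rewrite fs0 f0.
  rewrite q1; move: ((s - t)%:C) st0 => d d0.
  by field; rewrite fs0 f0 d0.
move=> [h1 h2]; split.
- by apply: cvg_trans h1; apply: near_eq_cvg; near=> s; congr complex.Re;
    near: s; exact: pE.
- by apply: cvg_trans h2; apply: near_eq_cvg; near=> s; congr complex.Im;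
    near: s; exact: pE.
Unshelve. all: by end_near.
Qed.

End ComplexDerivatives.

(** * Continuously differentiable complex-valued functions *)

Section C1.
Variable R : realType.
Implicit Types (f g : R -> R[i]) (s t : R) (k l : R[i]) (U : set R).

Definition cC1 U f := exists g, forall t, U t ->
  cderiv f t (g t) /\ ccvg (nbhs t) g (g t).

Lemma eq_cderiv f g t l : (\forall s \near t, f s = g s) ->
  cderiv f t l -> cderiv g t l.
Proof.
move=> fg [d1 d2]; split.
- by apply: near_eq_is_derive d1; near=> s;
    congr complex.Re; near: s; exact: fg.
- by apply: near_eq_is_derive d2; near=> s;
    congr complex.Im; near: s; exact: fg.
Unshelve. all: by end_near.
Qed.

Lemma eq_cC1 U f g : open U -> (forall t, U t -> f t = g t) ->
  cC1 U f -> cC1 U g.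
Proof.
move=> oU fg [f' df]; exists f' => t Ut; have [d c] := df t Ut; split => //.
by apply: eq_cderiv d; apply: filterS (open_nbhs_nbhs (conj oU Ut)) => s /fg.
Qed.

Lemma cC1_sub U V f : V `<=` U -> cC1 U f -> cC1 V f.
Proof. by move=> VU [f' df]; exists f' => t /VU /df. Qed.

Lemma cC1_ccvg U f t : cC1 U f -> U t -> ccvg (nbhs t) f (f t).
Proof. by move=> [f' df] /df [/cderiv_ccvg]. Qed.

Lemma cC1_cst U k : cC1 U (fun=> k).
Proof. by exists (fun=> 0) => t _; split; [apply: cderiv_cst|apply: ccvg_cst]. Qed.

Lemma cC1D U f g : cC1 U f -> cC1 U g -> cC1 U (fun t => f t + g t).
Proof.
move=> [f' df] [g' dg]; exists (fun t => f' t + g' t) => t Ut.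
have [d1 c1] := df t Ut; have [d2 c2] := dg t Ut.
by split; [apply: cderivD|apply: ccvgD].
Qed.

Lemma cC1M U f g : cC1 U f -> cC1 U g -> cC1 U (fun t => f t * g t).
Proof.
move=> [f' df] [g' dg]; exists (fun t => f' t * g t + f t * g' t) => t Ut.
have [d1 c1] := df t Ut; have [d2 c2] := dg t Ut.
split; first exact: cderivM.
by apply: ccvgD; apply: ccvgM => //; apply: cderiv_ccvg; eauto.
Qed.

Lemma cC1N U f : cC1 U f -> cC1 U (fun t => - f t).
Proof.
move=> cf; have := cC1M (cC1_cst U (-1)) cf.
by under [X in cC1 _ X]eq_fun do rewrite mulN1r.
Qed.

Lemma cC1B U f g : cC1 U f -> cC1 U g -> cC1 U (fun t => f t - g t).
Proof. by move=> cf cg; apply: cC1D => //; apply: cC1N. Qed.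

Lemma cC1J U f : cC1 U f -> cC1 U (fun t => (f t)^*).
Proof.
move=> [f' df]; exists (fun t => (f' t)^*) => t Ut; have [d c] := df t Ut.
by split; [apply: cderivJ|apply: ccvgJ].
Qed.

Lemma cC1V U f : (forall t, U t -> f t != 0) -> cC1 U f ->
  cC1 U (fun t => (f t)^-1).
Proof.
move=> f0 [f' df]; exists (fun t => - f' t / f t ^+ 2) => t Ut.
have [d c] := df t Ut; have f0t := f0 t Ut.
split; first exact: cderivV.
apply: ccvgM; first exact: ccvgN.
apply: ccvgV; first by rewrite expf_neq0.
by apply: ccvgX; apply: cderiv_ccvg d.
Qed.

Lemma cC1_sum U (I : Type) (r : seq I) (f : I -> R -> R[i]) :
  (forall i, cC1 U (f i)) -> cC1 U (fun t => \sum_(i <- r) f i t).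
Proof.
move=> cf; elim: r => [|i r IH].
  by under [X in cC1 _ X]eq_fun do rewrite big_nil; apply: cC1_cst.
by under [X in cC1 _ X]eq_fun do rewrite big_cons; apply: cC1D.
Qed.

Lemma cC1X U f n : cC1 U f -> cC1 U (fun t => f t ^+ n).
Proof.
move=> cf; elim: n => [|n IH].
  by under [X in cC1 _ X]eq_fun do rewrite expr0; apply: cC1_cst.
by under [X in cC1 _ X]eq_fun do rewrite exprS; apply: cC1M.
Qed.

(** On an open set any two derivatives agree near each point, so continuity passes from an arbitrary
    witness [h'] to [derive1 h]. *)
Lemma C1_onP U (h : R -> R) : open U -> C1_on U h <->
  exists h', forall t, U t -> is_derive t (1 : R) h (h' t) /\ {for t, continuous h'}.
Proof.
move=> oU; split.
  move=> c1; exists (derive1 h) => t /c1 [d c]; split; last exact: c.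
  by apply: DeriveDef; [exact: d|rewrite derive1E].
move=> [h' dh] t Ut; have [d c] := dh t Ut; split; first exact: ex_derive.
have E s : U s -> h' s = derive1 h s.
  by move=> /dh [ds _]; rewrite derive1E derive_val.
rewrite /prop_for /continuous_at -(E t Ut).
apply: cvg_trans c; apply: near_eq_cvg.
by apply: filterS (open_nbhs_nbhs (conj oU Ut)) => s /E.
Qed.

Lemma C1c_onP U f : open U -> C1c_on U f <-> cC1 U f.
Proof.
move=> oU; rewrite /C1c_on; split.
  move=> [/(C1_onP _ oU) [u du] /(C1_onP _ oU) [v dv]].
  exists (fun t => u t +i* v t) => t Ut.
  by have [d1 c1] := du t Ut; have [d2 c2] := dv t Ut.
move=> [g dg]; split; apply/(C1_onP _ oU).
  by exists (fun t => complex.Re (g t)) => t /dg [[d1 d2] [c1 c2]].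
by exists (fun t => complex.Im (g t)) => t /dg [[d1 d2] [c1 c2]].
Qed.

End C1.

                                                                  

(** * Integration against a measure given by a density *)

Section Density.
Context d (T : measurableType d) (R : realType).
Variables (nu mu : {measure set T -> \bar R}) (g : T -> R).
Hypotheses (mg : measurable_fun setT g) (g0 : forall x, 0 <= g x).
Hypothesis nuE : forall A, measurable A ->
  nu A = (\int[mu]_(x in A) (g x)%:E)%E.

Import HBNNSimple.

(** Both sides are monotone limits over the same simple functions approximating [f], and on a level
    set of a simple function the identity is [nuE]. *)
Lemma ge0_integral_density (f : T -> R) : (forall x, 0 <= f x) ->
  measurable_fun setT f ->
  (\int[nu]_x (f x)%:E = \int[mu]_x (f x * g x)%:E)%E.
Proof.
move=> f0 mf.
have mEf : measurable_fun setT (EFin \o f) by apply/measurable_EFinP.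
have mEg : measurable_fun setT (EFin \o g) by apply/measurable_EFinP.
pose h := nnsfun_approx measurableT mEf.
have f0' x : setT x -> (0 <= (EFin \o f) x)%E by rewrite lee_fin.
have -> : (\int[nu]_x (f x)%:E =
    lim (\int[nu]_x (EFin \o h n) x @[n --> \oo]))%E.
  have fE x : setT x -> ((f x)%:E = lim ((EFin \o h n) x @[n --> \oo]))%E.
    by move=> _; apply/esym/cvg_lim => //; exact: (cvg_nnsfun_approx _ _ f0').
  under eq_integral => x /[!inE] /fE -> //.
  apply: monotone_convergence => //.
  - by move=> n; apply/measurable_EFinP; exact/measurable_funP.
  - by move=> n x Ex //=; rewrite lee_fin.
  - by move=> x Ex a b ab; rewrite lee_fin; exact/lefP/nd_nnsfun_approx.
have -> : (\int[mu]_x (f x * g x)%:E =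
    lim (\int[mu]_x ((EFin \o h n) \* (EFin \o g)) x @[n --> \oo]))%E.
  have fg x : setT x ->
      ((f x * g x)%:E = lim (((EFin \o h n) \* (EFin \o g)) x @[n --> \oo]))%E.
    move=> _; apply/esym/cvg_lim => //; rewrite EFinM; apply: cvgeZr => //.
    exact: (cvg_nnsfun_approx _ _ f0').
  under eq_integral => x /[!inE] /fg -> //.
  apply: monotone_convergence => [//| | |].
  - by move=> n; apply/emeasurable_funM => //; exact/measurable_EFinP.
  - by move=> n x Ex /=; rewrite mule_ge0 ?lee_fin.
  - move=> x Ex a b ab/=; rewrite lee_wpmul2r ?lee_fin//.
    exact/lefP/nd_nnsfun_approx.
suff suf n : (\int[mu]_x ((EFin \o h n) x * (g x)%:E) =
    \int[nu]_x (EFin \o h n) x)%E.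
  by under [in RHS]eq_fun do rewrite suf.
transitivity (\int[nu]_x
   (\sum_(y \in range (h n)) (y * \1_(h n @^-1` [set y]) x)%:E))%E; last first.
  by apply: eq_integral => t tE; rewrite /= fimfunE -fsumEFin.
have indich m r :
    measurable_fun setT (fun x => (r * \1_(h m @^-1` [set r]) x)%:E).
  by apply: (measurable_comp measurableT) => //; exact: measurable_funM.
rewrite ge0_integral_fsum//; last by move=> m y Ey; exact: nnfun_muleindic_ge0.
transitivity (\int[mu]_x (\sum_(y \in range (h n))
    (y * \1_(h n @^-1` [set y]) x)%:E * (g x)%:E))%E.
  under [RHS]eq_integral => x xE.
    rewrite -ge0_mule_fsuml => [|y]; last exact: nnfun_muleindic_ge0.
    rewrite fsumEFin // -(fimfunE _ x); over.
  by [].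
rewrite ge0_integral_fsum//; last 2 first.
  - by move=> y; apply: emeasurable_funM.
  - by move=> m y Ey; apply: mule_ge0; rewrite ?lee_fin//;
      exact: nnfun_muleindic_ge0.
apply: eq_fsbigr => r rhn.
under [RHS]eq_integral do rewrite EFinM.
rewrite integralZl_indic_nnsfun => //.
under eq_integral do rewrite EFinM -muleA.
rewrite ge0_integralZl//.
- under eq_integral do rewrite muleC.
  rewrite (eq_integral ((EFin \o g) \_ (h n @^-1` [set r]))); last first.
    by move=> x xE; rewrite epatch_indic.
  by rewrite -integral_mkcond /= -nuE// integral_indic// setIT.
- by apply: emeasurable_funM => //; exact/measurable_EFinP.
- by move=> t Et; rewrite mule_ge0 ?lee_fin.
- by move: rhn; rewrite inE => -[t _ <-]; rewrite lee_fin.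
Qed.

Hypothesis nu_fin : (nu setT < +oo)%E.

Lemma integrable_density : mu.-integrable setT (EFin \o g).
Proof.
apply/integrableP; split; first exact/measurable_EFinP.
by under eq_integral do rewrite gee0_abs ?lee_fin//; rewrite -nuE.
Qed.

(** Adding the bound [C] makes the integrand nonnegative; both measures give the constant the same
    integral, which cancels. *)
Lemma Rintegral_density (f : T -> R) (C : R) : (forall x, `|f x| <= C) ->
  measurable_fun setT f ->
  Rintegral nu setT f = Rintegral mu setT (fun x => f x * g x).
Proof.
move=> fC mf.
have bf : [bounded f x | x in setT].
  by exists C; split; rewrite ?num_real // => y Cy x _; apply: le_trans (ltW Cy).
have intf : nu.-integrable setT (EFin \o f) by apply: measurable_bounded_integrable.
have intc c : nu.-integrable setT (EFin \o cst c).
  apply: measurable_bounded_integrable => //; exact: bounded_cst.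
have intfg : mu.-integrable setT (EFin \o (fun x => f x * g x)).
  exact: (integrableMr measurableT mf bf integrable_density).
have intCg : mu.-integrable setT (EFin \o (fun x => C * g x)).
  exact: (integrableZl measurableT C integrable_density).
have : Rintegral nu setT (fun x => f x + C) =
       Rintegral mu setT (fun x => (f x + C) * g x).
  rewrite /Rintegral ge0_integral_density //.
    by move=> x; rewrite -lerBlDr sub0r; have := fC x; rewrite ler_norml => /andP[].
  exact: measurable_funD.
rewrite RintegralD //; last exact: (intc C).
under [in RHS]eq_Rintegral do rewrite mulrDl.
rewrite RintegralD // RintegralZl //; last exact: integrable_density.
rewrite Rintegral_cst //.
have -> : Rintegral mu setT g = fine (nu setT) by rewrite nuE.
by move/addIr.
Qed.

End Density.

Lemma ae_eq_Rintegral d (T : measurableType d) (R : realType)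
  (mu : {measure set T -> \bar R}) (D : set T) (f g : T -> R) :
  measurable D -> measurable_fun D f -> measurable_fun D g ->
  {ae mu, forall x, D x -> f x = g x} -> Rintegral mu D f = Rintegral mu D g.
Proof.
move=> mD mf mg fg; congr fine; apply: ae_eq_integral => //.
- exact/measurable_EFinP.
- exact/measurable_EFinP.
- by apply: filterS fg => x fgx Dx; rewrite fgx.
Qed.

(** * Differentiation in [t] of integrals against [mut t] *)

Section Family.
Context {R : realType} {D D0 J : set R} {mu : {measure set R -> \bar R}}.
Context {omega : R -> R -> \bar R} {mut : R -> {finite_measure set R -> \bar R}}.
Context {alpha : R -> R}.
Hypotheses (mD : measurable D) (mD0 : measurable D0) (D0D : D0 `<=` D).
Hypotheses (D00 : mu (D `\` D0) = 0%E) (oJ : open J).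
Hypothesis dens : forall t, J t -> has_density D (mut t) mu (omega^~ t).
Hypothesis reg : forall theta t, D0 theta -> J t ->
  omega theta t \is a fin_num /\ derivable_t omega theta t.
Hypothesis alpha_int : mu.-integrable D (EFin \o alpha).
Hypothesis dom : forall theta t, D0 theta -> J t -> `|d_t omega theta t| <= alpha theta.

Let w t theta := fine (omega theta t).

Let mw t : J t -> measurable_fun D0 (w t).
Proof.
move=> /dens [mo _ _]; apply: measurableT_comp => //.
exact: measurable_funS mo.
Qed.

Lemma ae_density_ge0 t : J t -> {ae mu, forall theta, D0 theta -> 0 <= w t theta}.
Proof.
move=> /dens [_ o0 _]; apply: filterS o0 => x ox D0x.
by apply: fine_ge0; apply: ox; apply: D0D.
Qed.

(** [D0] is a subset of full measure in [D] on which the regularity assumptions hold at every point.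
    The density is nonnegative only almost everywhere, so it is truncated at zero and extended by
    zero; the result is a density on the whole line that is nonnegative everywhere, as the density
    lemmas require. *)
Let g t := (fun theta => Num.max 0 (w t theta)) \_ D0.

Let g_ge0 t x : 0 <= g t x.
Proof. by rewrite /g patchE; case: ifP => // _; rewrite le_max lexx. Qed.

Let mmax t : J t -> measurable_fun D0 (fun theta => Num.max 0 (w t theta)).
Proof.
move=> Jt; have m0 : measurable_fun D0 (cst (0 : R)) by apply: measurable_cst.
exact: measurable_maxr m0 (mw Jt).
Qed.

Let mg t : J t -> measurable_fun setT (g t).
Proof.
by move=> Jt; apply/(measurable_restrictT _ mD0); apply: mmax.
Qed.

Let gE t : J t -> forall A, measurable A ->
  mut t A = (\int[mu]_(x in A) (g t x)%:E)%E.
Proof.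
move=> Jt A mA; have [mo _ ->] := dens Jt => //.
have mgE : measurable_fun (A `&` D) (EFin \o g t).
  by apply/measurable_EFinP; apply: measurable_funTS; apply: mg.
rewrite (ae_eq_integral (EFin \o g t)) //; first last.
- have aeN : {ae mu, forall x, ~ (D `\` D0) x}.
    exists (D `\` D0); split => //; first exact: measurableD.
    by move=> x /= /contrapT.
  have o0 := ae_density_ge0 Jt.
  apply: filterS2 aeN o0 => x nDx ox [Ax Dx].
  have D0x : D0 x by apply: contrapT => nD0x; apply: nDx.
  have [fo _] := reg D0x Jt.
  by rewrite /= /g patchE mem_set //= max_r ?ox // /w fineK.
- apply: measurable_funS mo => //; exact: measurableI.
- exact: measurableI.
rewrite integral_mkcondr; apply: eq_integral => x _.
rewrite patchE; case: ifPn => // /negP; rewrite inE => nDx.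
by rewrite /g patchE memNset // => /D0D.
Qed.

Let mutfin t : (mut t setT < +oo)%E.
Proof. exact: fin_num_fun_lty. Qed.

Lemma integrable_weight t : J t -> mu.-integrable D0 (EFin \o w t).
Proof.
move=> Jt.
have : mu.-integrable D0 (EFin \o g t).
  apply: (integrableS measurableT) => //.
  exact: (integrable_density (mg Jt) (@g_ge0 t) (gE Jt) (mutfin t)).
have mwE : measurable_fun D0 (EFin \o w t) by apply/measurable_EFinP; exact: mw.
have mgE : measurable_fun D0 (EFin \o g t).
  by apply/measurable_EFinP; apply: measurable_funTS; apply: mg.
move=> /integrableP [_ gfin]; apply/integrableP; split => //.
apply: le_lt_trans gfin; rewrite le_eqVlt; apply/orP; left; apply/eqP.
apply: ae_eq_integral => //; try exact: measurableT_comp.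
apply: filterS (ae_density_ge0 Jt) => x ox D0x.
by rewrite /= /g patchE mem_set //= max_r ?ox.
Qed.

Variables (f : R -> R) (C : R).
Hypotheses (fC : forall x, `|f x| <= C) (mf : measurable_fun setT f).

Let mfD : measurable_fun D0 f. Proof. exact: measurable_funTS. Qed.

Let bf : [bounded f x | x in D0].
Proof.
by exists C; split; rewrite ?num_real // => y Cy x _; apply: le_trans (ltW Cy).
Qed.

Lemma Rintegral_mut t : J t ->
  Rintegral (mut t) setT f = Rintegral mu D0 (fun x => f x * w t x).
Proof.
move=> Jt.
rewrite (Rintegral_density (mu := mu) (mg Jt) (@g_ge0 t) (gE Jt) (mutfin t) fC mf).
have -> : (fun x => f x * g t x) =
    (fun x => f x * Num.max 0 (w t x)) \_ D0.
  apply: funext => x; rewrite /g !patchE; case: ifP => // _.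
  by rewrite mulr0.
rewrite -Rintegral_mkcond; apply: ae_eq_Rintegral => //.
- by apply: measurable_funM => //; apply: mmax.
- by apply: measurable_funM => //; apply: mw.
- by apply: filterS (ae_density_ge0 Jt) => x ox D0x; rewrite max_r ?ox.
Qed.

Let intfw t : J t -> mu.-integrable D0 (EFin \o (fun x => f x * w t x)).
Proof. by move=> Jt; exact: (integrableMr mD0 mfD bf (integrable_weight Jt)). Qed.

Let itvJ t : J t -> exists e : R, 0 < e /\ `]t - e, t + e[ `<=` J.
Proof.
move=> Jt; have /nbhs_ballP[e /= e0 eJ] := open_nbhs_nbhs (conj oJ Jt).
exists e; split => // s; rewrite /= in_itv /= => /andP[s1 s2]; apply: eJ.
by rewrite /ball /= ltr_norml; lra.
Qed.

Let iG : mu.-integrable D0 (EFin \o (fun x => C * `|alpha x|)).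
Proof.
have ia : mu.-integrable D0 (EFin \o alpha) by exact: integrableS alpha_int.
have := integrableZl mD0 C (integrable_norm ia).
by [].
Qed.

Let C0 : 0 <= C. Proof. by apply: le_trans (fC 0). Qed.

Let dE t theta : J t -> D0 theta ->
  is_derive t 1 (fun s => f theta * w s theta) (f theta * d_t omega theta t).
Proof.
move=> Jt Dt; have [_ dt] := reg Dt Jt.
have i1 : is_derive t 1 (fun s => w s theta) (d_t omega theta t).
  by apply: DeriveDef; [exact: dt|rewrite /d_t derive1E].
exact: (is_deriveZ (f theta) i1).
Qed.

(** Since [f] is bounded by [C], the integrable function [C * |alpha|] dominates the differentiated
    integrand, uniformly in the parameter. *)
Lemma is_derive_Rintegral_mut t : J t ->
  is_derive t 1 (fun s => Rintegral (mut s) setT f)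
    (Rintegral mu D0 (fun theta => f theta * d_t omega theta t)).
Proof.
move=> Jt; have [e [e0 eJ]] := itvJ Jt.
have te : `]t - e, t + e[%classic t by rewrite /= in_itv /=; lra.
pose F s theta := f theta * w s theta.
have i1 s : `]t - e, t + e[%classic s -> mu.-integrable D0 (EFin \o F s).
  by move=> /eJ; exact: intfw.
have i2 s theta : `]t - e, t + e[%classic s -> D0 theta -> derivable (F^~ theta) s 1.
  by move=> /eJ Js Dt; have i := dE Js Dt; exact: ex_derive.
have pE s theta : J s -> D0 theta -> partial1of2 F s theta = f theta * d_t omega theta s.
  by move=> Js Dt; rewrite partial1of2E; have i := dE Js Dt; exact: derive_val.
have i3 theta : 0 <= C * `|alpha theta| by rewrite mulr_ge0.
have i4 s theta : `]t - e, t + e[%classic s -> D0 theta ->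
    `|partial1of2 F s theta| <= C * `|alpha theta|.
  move=> /eJ Js Dt; rewrite pE // normrM ler_pM //.
  by apply: le_trans (dom Dt Js) _; exact: ler_norm.
have d1 := derivable_under_integral mD0 te i1 i2 i3 iG i4.
have d2 := differentiation_under_integral mD0 te i1 i2 i3 iG i4.
have : is_derive t 1 (fun s => Rintegral mu D0 (F s))
    (Rintegral mu D0 (fun theta => f theta * d_t omega theta t)).
  apply: DeriveDef; first exact: d1.
  rewrite -derive1E d2; apply: eq_Rintegral => x; rewrite inE => Dx.
  exact: pE.
apply: near_eq_is_derive.
have := open_nbhs_nbhs (conj oJ Jt).
by apply: filterS => s Js; rewrite Rintegral_mut.
Qed.

(** The derivative is the pointwise limit on [D0] of difference quotients along one sequence of
    steps. *)
Lemma measurable_d_t t : J t -> measurable_fun D0 (fun theta => d_t omega theta t).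
Proof.
move=> Jt; have [e [e0 eJ]] := itvJ Jt.
(* With [n.+2] in the denominator every step is strictly less than [e], so [h n + t] stays in
   [J]. *)
pose h (n : nat) : R := e * (n.+2%:R)^-1.
have h0 n : h n != 0 by rewrite mulf_neq0 // ?gt_eqF // invr_gt0.
have hc : h n @[n --> \oo] --> (0 : R).
  rewrite -(mulr0 e); apply: cvgM; first exact: cvg_cst.
  have : @harmonic R @ \oo --> (0 : R) by exact: cvg_harmonic.
  by rewrite -cvg_shiftS; exact.
have hJ n : J (h n + t).
  apply: eJ; rewrite /= in_itv /=.
  have hn0 : 0 < h n by rewrite mulr_gt0 // invr_gt0.
  have hn1 : h n < e by rewrite /h gtr_pMr // invf_lt1 // ltr1n.
  lra.
pose G n theta := (h n)^-1 * (w (h n + t) theta - w t theta).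
apply/measurable_EFinP.
apply: (@emeasurable_fun_cvg _ _ _ _ (fun n theta => (G n theta)%:E)).
  move=> n; apply/measurable_EFinP; apply: measurable_funM; first exact: measurable_cst.
  by apply: measurable_funB; apply: mw.
move=> theta Dt; have [_ dt] := reg Dt Jt.
apply: cvg_EFin; first exact: nearW.
have := dt; rewrite /derivable_t /derivable => /cvg_ex [l dl].
have -> : d_t omega theta t = l.
  by apply/cvg_lim => //; move: dl; under eq_fun do rewrite scaler1.
move/cvgr_dnbhsP : dl => /(_ h); move=> /(_ (conj h0 hc)).
rewrite /comp /=; under eq_fun do rewrite scaler1; exact.
Qed.

Lemma integrable_d_t t : J t ->
  mu.-integrable D0 (EFin \o (fun theta => f theta * d_t omega theta t)).
Proof.
move=> Jt; apply: le_integrable iG => //.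
  by apply/measurable_EFinP; apply: measurable_funM => //; apply: measurable_d_t.
move=> x Dx /=; rewrite lee_fin normrM [leRHS]ger0_norm ?mulr_ge0 //.
by rewrite ler_pM //; apply: le_trans (dom Dx Jt) _; exact: ler_norm.
Qed.

Lemma continuous_Rintegral_d_t (U : set R) t : open U -> U `<=` J -> U t ->
  (forall theta s, D0 theta -> U s -> {for s, continuous (d_t omega theta)}) ->
  {for t, continuous (fun s => Rintegral mu D0 (fun theta => f theta * d_t omega theta s))}.
Proof.
move=> oU UJ Ut dc.
have /nbhs_ballP[e /= e0 eU] := open_nbhs_nbhs (conj oU Ut).
have {}eU : `]t - e, t + e[ `<=` U.
  move=> s; rewrite /= in_itv /= => /andP[s1 s2]; apply: eU.
  by rewrite /ball /= ltr_norml; lra.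
have te : t \in `]t - e, t + e[%classic by rewrite inE /= in_itv /=; lra.
have := @continuity_under_integral R _ _ mu
  (fun s theta => f theta * d_t omega theta s) D0 mD0 (t - e) (t + e).
move=> /(_ _ _ (fun x => C * `|alpha x|) iG _ t te); apply.
- by move=> s /eU /UJ; exact: integrable_d_t.
- apply: aeW => theta Dt s; rewrite inE => /eU Us.
  by apply: cvgM; [exact: cvg_cst|exact: dc].
- move=> s /eU /UJ Js; apply: aeW => theta Dt.
  by rewrite normrM ler_pM //; apply: le_trans (dom Dt Js) _; exact: ler_norm.
Qed.

End Family.

                                                                     

(** * Linear functionals and the sesquilinear form on polynomials over the circle *)

Section TrigonometricFunctionals.
Variable R : realType.
Implicit Types (f g : R -> R) (u v : R -> R[i]) (F G H : {poly R[i]}).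

Definition bm f := measurable_fun setT f /\ exists C : R, forall x, `|f x| <= C.

Lemma bm_cst (c : R) : bm (fun=> c).
Proof. by split; [apply: measurable_cst|exists `|c|]. Qed.

Lemma bmD f g : bm f -> bm g -> bm (fun x => f x + g x).
Proof.
move=> [mf [C fC]] [mg [K gK]]; split; first exact: measurable_funD.
by exists (C + K) => x; rewrite (le_trans (ler_normD _ _)) // lerD.
Qed.

Lemma bmM f g : bm f -> bm g -> bm (fun x => f x * g x).
Proof.
move=> [mf [C fC]] [mg [K gK]]; split; first exact: measurable_funM.
by exists (C * K) => x; rewrite normrM ler_pM.
Qed.

Lemma bmN f : bm f -> bm (fun x => - f x).
Proof.
move=> bf; have := bmM (bm_cst (-1)) bf.
by under [X in bm X]eq_fun do rewrite mulN1r.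
Qed.

Definition cbm u := bm (fun x => complex.Re (u x)) /\ bm (fun x => complex.Im (u x)).

Lemma cbm_cst (c : R[i]) : cbm (fun=> c).
Proof. by split; apply: bm_cst. Qed.

Lemma cbmD u v : cbm u -> cbm v -> cbm (fun x => u x + v x).
Proof.
move=> [u1 u2] [v1 v2]; split.
- by under [X in bm X]eq_fun do rewrite ReD; apply: bmD.
- by under [X in bm X]eq_fun do rewrite ImD; apply: bmD.
Qed.

Lemma cbmM u v : cbm u -> cbm v -> cbm (fun x => u x * v x).
Proof.
move=> [u1 u2] [v1 v2]; split.
- under [X in bm X]eq_fun do rewrite ReM.
  by apply: bmD; [|apply: bmN]; apply: bmM.
- by under [X in bm X]eq_fun do rewrite ImM; apply: bmD; apply: bmM.
Qed.

Lemma ReJ (z : R[i]) : complex.Re z^* = complex.Re z. Proof. by case: z. Qed.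

Lemma ImJ (z : R[i]) : complex.Im z^* = - complex.Im z. Proof. by case: z. Qed.

Lemma cbmJ u : cbm u -> cbm (fun x => (u x)^*).
Proof.
move=> [u1 u2]; split.
- by under [X in bm X]eq_fun do rewrite ReJ.
- by under [X in bm X]eq_fun do rewrite ImJ; apply: bmN.
Qed.

Lemma cbm_cis : cbm (@cis R).
Proof.
split; split => /=.
- by apply: continuous_measurable_fun; apply: continuous_cos.
- by exists 1 => x; rewrite ler_norml cos_geN1 cos_le1.
- by apply: continuous_measurable_fun; apply: continuous_sin.
- by exists 1 => x; rewrite ler_norml sin_geN1 sin_le1.
Qed.

Lemma cbm_horner F : cbm (fun x => F.[cis x]).
Proof.
elim/poly_ind: F => [|F c IH].
  by under [X in cbm X]eq_fun do rewrite horner0; apply: cbm_cst.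
under [X in cbm X]eq_fun do rewrite hornerMXaddC.
by apply: cbmD; [apply: cbmM => //; apply: cbm_cis|apply: cbm_cst].
Qed.

Lemma cbm_prod F G : cbm (fun x => F.[cis x] * (G.[cis x])^*).
Proof. by apply: cbmM; [|apply: cbmJ]; apply: cbm_horner. Qed.

Lemma cis_norm (x : R) : cis x * (cis x)^* = 1.
Proof.
apply/eqP; rewrite eq_complex ReM ImM /=; apply/andP; split; apply/eqP.
  by rewrite -(cos2Dsin2 x); ring.
by ring.
Qed.

(** Working with an abstract functional lets the same algebra serve integration against [mut t] and
    its derivative in [t], which need not be positive. Linearity is asked on bounded measurable
    functions, where the integrals exist. *)
Definition fun_linear (E : (R -> R) -> R) :=
  (forall f g, bm f -> bm g -> E (fun x => f x + g x) = E f + E g) /\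
  (forall c f, bm f -> E (fun x => c * f x) = c * E f).

Definition CE (E : (R -> R) -> R) u : R[i] :=
  E (fun x => complex.Re (u x)) +i* E (fun x => complex.Im (u x)).

Definition ip E F G := CE E (fun x => F.[cis x] * (G.[cis x])^*).

Section Linear.
Variables (E : (R -> R) -> R) (linE : fun_linear E).

Let ED f g : bm f -> bm g -> E (fun x => f x + g x) = E f + E g.
Proof. by case: linE => h _; exact: h. Qed.

Let EZ c f : bm f -> E (fun x => c * f x) = c * E f.
Proof. by case: linE => _; exact. Qed.

Let EN f : bm f -> E (fun x => - f x) = - E f.
Proof.
move=> bf; rewrite -mulN1r -(EZ _ bf); congr E.
by apply: funext => x; rewrite mulN1r.
Qed.

Lemma eq_CE u v : (forall x, u x = v x) -> CE E u = CE E v.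
Proof. by move=> uv; congr CE; apply: funext. Qed.

Lemma CED u v : cbm u -> cbm v -> CE E (fun x => u x + v x) = CE E u + CE E v.
Proof.
move=> [u1 u2] [v1 v2]; apply/eqP; rewrite /CE eq_complex ReD ImD /=.
by rewrite -(ED u1 v1) -(ED u2 v2); apply/andP; split; apply/eqP; congr E;
  apply: funext => x; rewrite ?ReD ?ImD.
Qed.

Lemma CEZ (c : R[i]) u : cbm u -> CE E (fun x => c * u x) = c * CE E u.
Proof.
move=> [u1 u2]; apply/eqP; rewrite /CE eq_complex ReM ImM /=.
have b1 (k : R) f : bm f -> bm (fun x => k * f x) by apply: bmM; apply: bm_cst.
rewrite -!EZ // -(EN (b1 _ _ u2)) -(ED (b1 _ _ u1) (bmN (b1 _ _ u2))).
rewrite -(ED (b1 _ _ u2) (b1 _ _ u1)).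
by apply/andP; split; apply/eqP; congr E;
  apply: funext => x; rewrite ?ReM ?ImM.
Qed.

Lemma CEJ u : cbm u -> CE E (fun x => (u x)^*) = (CE E u)^*.
Proof.
move=> [u1 u2]; apply/eqP; rewrite /CE eq_complex ReJ ImJ /= -EN //.
by apply/andP; split; apply/eqP; congr E; apply: funext => x; rewrite ?ReJ ?ImJ.
Qed.

Lemma ipDl F G H : ip E (F + G) H = ip E F H + ip E G H.
Proof.
rewrite /ip -CED; try exact: cbm_prod.
by apply: eq_CE => x; rewrite hornerD mulrDl.
Qed.

Lemma ipZl c F G : ip E (c *: F) G = c * ip E F G.
Proof.
rewrite /ip -CEZ; last exact: cbm_prod.
by apply: eq_CE => x; rewrite hornerZ mulrA.
Qed.

Lemma ipJ F G : (ip E F G)^* = ip E G F.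
Proof.
rewrite /ip -CEJ; last exact: cbm_prod.
by apply: eq_CE => x; rewrite rmorphM /= conjCK mulrC.
Qed.

Lemma ip0l G : ip E 0 G = 0.
Proof. by rewrite -(scale0r (0 : {poly R[i]})) ipZl mul0r. Qed.

Lemma ip_suml (I : Type) (r : seq I) (F : I -> {poly R[i]}) G :
  ip E (\sum_(i <- r) F i) G = \sum_(i <- r) ip E (F i) G.
Proof.
elim: r => [|i r IH]; first by rewrite !big_nil ip0l.
by rewrite !big_cons ipDl IH.
Qed.

Lemma ipDr F G H : ip E F (G + H) = ip E F G + ip E F H.
Proof. by rewrite -ipJ ipDl raddfD /= !ipJ. Qed.

Lemma ipZr c F G : ip E F (c *: G) = c^* * ip E F G.
Proof. by rewrite -ipJ ipZl rmorphM /= ipJ. Qed.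

Lemma ip0r F : ip E F 0 = 0.
Proof. by rewrite -ipJ ip0l conjC0. Qed.

Lemma ip_sumr (I : Type) (r : seq I) F (G : I -> {poly R[i]}) :
  ip E F (\sum_(i <- r) G i) = \sum_(i <- r) ip E F (G i).
Proof.
elim: r => [|i r IH]; first by rewrite !big_nil ip0r.
by rewrite !big_cons ipDr IH.
Qed.

Lemma ipNl F G : ip E (- F) G = - ip E F G.
Proof. by rewrite -scaleN1r ipZl mulN1r. Qed.

Lemma ipBl F G H : ip E (F - G) H = ip E F H - ip E G H.
Proof. by rewrite ipDl ipNl. Qed.

(** Identities between pairings become algebra on the circle, where conjugation is inversion; this
    is how factors are moved from one argument to the other. *)
Lemma eq_ip F G F' G' :
  (forall z, z * z^* = 1 -> F.[z] * (G.[z])^* = F'.[z] * (G'.[z])^*) ->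
  ip E F G = ip E F' G'.
Proof. by move=> FG; apply: eq_CE => x; apply: FG; apply: cis_norm. Qed.

Lemma ip_expand (m n : nat) F G : (size F <= m)%N -> (size G <= n)%N ->
  ip E F G = \sum_(j < m) \sum_(k < n) F`_j * (G`_k)^* * ip E 'X^j 'X^k.
Proof.
move=> sF sG.
have polyE (p : {poly R[i]}) k : (size p <= k)%N ->
      p = \sum_(i < k) p`_i *: ('X^i : {poly R[i]}).
  by move=> sp; rewrite -poly_def; apply/polyP => i; rewrite coef_poly;
    case: ltnP => // ki; rewrite nth_default // (leq_trans sp).
rewrite {1}(polyE _ _ sF) {1}(polyE _ _ sG) ip_suml; apply: eq_bigr => j _.
rewrite ip_sumr; apply: eq_bigr => k _.
by rewrite ipZl ipZr mulrA.
Qed.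

Hypothesis E_ge0 : forall f, bm f -> (forall x, 0 <= f x) -> 0 <= E f.

Lemma ip_ge0 F : 0 <= ip E F F.
Proof.
rewrite lecE /ip /CE /=; apply/andP; split.
  rewrite (_ : (fun x => _) = fun x => 0 * (0 : R)).
    by rewrite EZ ?mul0r //; apply: bm_cst.
  apply: funext => x; rewrite mul0r.
  by rewrite ImM ReJ ImJ; ring.
apply: E_ge0; first by have [] := cbm_prod F F.
move=> x; rewrite ReM ReJ ImJ mulrN opprK -!expr2.
by rewrite addr_ge0 // sqr_ge0.
Qed.

End Linear.

End TrigonometricFunctionals.

(** * Orthogonal and paraorthogonal polynomials, and the location of their zeros *)

Section OrthogonalPolynomials.
Variables (R : realType) (E : (R -> R) -> R) (linE : fun_linear E).
Hypothesis E_ge0 : forall f, bm f -> (forall x, 0 <= f x) -> 0 <= E f.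
Variable Q : nat -> {poly R[i]}.
Hypothesis Q_monic : forall n, Q n \is monic /\ size (Q n) = n.+1.
Hypothesis Q_orth : forall n m, n != m -> ip E (Q n) (Q m) = 0.
Hypothesis Q_neq0 : forall n, ip E (Q n) (Q n) != 0.
Implicit Types (F G H T : {poly R[i]}).

(** The [Q k] are monic, one in each degree, hence a triangular basis; orthogonality identifies the
    coefficients. *)
Lemma opuc_coef m F : (size F <= m)%N ->
  F = \sum_(k < m) (ip E F (Q k) / ip E (Q k) (Q k)) *: Q k.
Proof.
suff suffF : (size F <= m)%N ->
    exists a : nat -> R[i], F = \sum_(k < m) a k *: Q k.
  move=> /suffF [a Fa].
  have ipF (k : 'I_m) : ip E F (Q k) = a k * ip E (Q k) (Q k).
    rewrite Fa ip_suml // (bigD1 k) //= ipZl // big1 ?addr0 // => j jk.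
    by rewrite ipZl // Q_orth ?mulr0.
  by rewrite {1}Fa; apply: eq_bigr => k _; rewrite ipF mulfK.
elim: m F => [|m IH] F.
  rewrite leqn0 size_poly_eq0 => /eqP ->.
  by exists (fun=> 0); rewrite big_ord0.
move=> sF; have [mQ sQ] := Q_monic m.
have /IH [a Fa] : (size (F - F`_m *: Q m)%R <= m)%N.
  apply/leq_sizeP => j mj; rewrite coefB coefZ.
  case: (ltngtP m j) mj => // [mj _|<- _].
    by rewrite [F`_j]nth_default ?(leq_trans sF) // [(Q m)`_j]nth_default ?sQ //
      mulr0 subr0.
  have := mQ; rewrite monicE lead_coefE sQ /= => /eqP ->.
  by rewrite mulr1 subrr.
exists (fun k => if k == m then F`_m else a k).
rewrite big_ord_recr /= eqxx -[LHS](subrK (F`_m *: Q m)) {}Fa.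
by congr (_ + _); apply: eq_bigr => k _; rewrite ltn_eqF.
Qed.

Lemma opuc_orth m F : (size F <= m)%N -> ip E (Q m) F = 0.
Proof.
move=> /opuc_coef ->; rewrite ip_sumr // big1 // => k _.
have mk : m != k by rewrite neq_ltn ltn_ord orbT.
by rewrite ipZr // (Q_orth mk) mulr0.
Qed.

(** By Parseval, [ip E F F] is the sum of the terms [|ip E F (Q k)| ^+ 2 / ip E (Q k) (Q k)], all
    nonnegative; if it vanishes, so does every coefficient of [F]. *)
Lemma ip_gt0 F : F != 0 -> 0 < ip E F F.
Proof.
move=> F0; rewrite lt0r ip_ge0 // andbT; apply: contraNneq F0.
have Fc := opuc_coef (leqnn (size F)).
rewrite {2}Fc ip_sumr //.
under eq_bigr => k _ do rewrite ipZr //.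
have kE k : (ip E F (Q k) / ip E (Q k) (Q k))^* * ip E F (Q k) =
    `|ip E F (Q k)| ^+ 2 / ip E (Q k) (Q k).
  by rewrite rmorphM /= fmorphV /= (ipJ linE (Q k) (Q k)) normCK; ring.
under eq_bigr => k _ do rewrite kE.
move/eqP; rewrite psumr_eq0; last first.
  by move=> k _; rewrite divr_ge0 ?ip_ge0 // exprn_ge0.
move=> /allP all0; rewrite Fc big1 // => k _.
have /implyP /(_ isT) := all0 k (mem_index_enum k).
by rewrite mulf_eq0 invr_eq0 (negbTE (Q_neq0 k)) orbF expf_eq0 /= normr_eq0 =>
  /eqP ->; rewrite mul0r scale0r.
Qed.

(** Only moments and polynomials of lower degree occur on the right, which is what the induction on
    regularity in [t] needs. *)
Lemma gram_schmidt m :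
  Q m = 'X^m - \sum_(k < m) (ip E 'X^m (Q k) / ip E (Q k) (Q k)) *: Q k.
Proof.
have [mQ sQ] := Q_monic m.
have s1 : (size ('X^m - Q m)%R <= m)%N.
  apply/leq_sizeP => j mj; rewrite coefB coefXn.
  case: (ltngtP m j) mj => // [mj _|<- _].
    by rewrite nth_default ?sQ // subrr.
  by have := mQ; rewrite monicE lead_coefE sQ /= => /eqP ->; rewrite subrr.
rewrite -[LHS](subKr 'X^m) (opuc_coef s1).
congr (_ - _); apply: eq_bigr => k _; congr (_ / _ *: _).
have mk : m != k by rewrite neq_ltn ltn_ord orbT.
by rewrite ipBl // (Q_orth mk) subr0.
Qed.

Lemma unit_circle_neq0 (z : R[i]) : z * z^* = 1 -> z != 0.
Proof. by apply: contra_eq_neq => ->; rewrite mul0r eq_sym oner_eq0. Qed.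

Lemma unit_circle_inv (z : R[i]) : z * z^* = 1 -> z^* = z^-1.
Proof.
move=> zz; have z0 := unit_circle_neq0 zz.
by rewrite -[LHS](mulKf z0) zz mulr1.
Qed.

Lemma ip_mulX F G : ip E ('X * F) ('X * G) = ip E F G.
Proof.
apply: eq_ip => // z zz; rewrite !hornerM !hornerX rmorphM /= mulrACA zz.
by rewrite mul1r.
Qed.

                                                                            
                                                                
(** Pythagoras: if [Q m = T * ('X - a)], then ['X * T = Q m + a *: T] with orthogonal summands.
    Multiplication by ['X] preserves norms and [|a| = 1], so [Q m] would have norm zero. *)
Lemma opuc_root_circle m (a : R[i]) : `|a| = 1 -> ~~ root (Q m) a.
Proof.
move=> a1; apply/negP => /factor_theorem [T QT].
have [mQ sQ] := Q_monic m.
have T0 : T != 0.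
  by apply: contraTneq mQ => T0; rewrite QT T0 mul0r monicE lead_coef0 eq_sym oner_eq0.
have sT : size T = m.
  by have := sQ; rewrite QT size_Mmonic ?monicXsubC // size_XsubC addn2 /= => -[].
have XT : 'X * T = Q m + a *: T by rewrite QT -mul_polyC; ring.
have := ip_mulX T T; rewrite XT ipDl // !ipDr // !ipZr // !ipZl //.
have QT0 : ip E (Q m) T = 0 by apply: opuc_orth; rewrite sT.
rewrite -(ipJ linE (Q m) T) QT0 conjC0 !mulr0 addr0 add0r mulrA.
rewrite [a^* * a]mulrC -normCK a1 expr1n mul1r.
by move/(canRL (addrK _)); rewrite subrr => /eqP; rewrite (negbTE (Q_neq0 m)).
Qed.

Section Popuc.
Variables (m : nat) (b : R[i]).
Hypothesis b1 : `|b| = 1.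
Let P : {poly R[i]} := 'X * Q m - (b^*)%:P * revpoly m (Q m).

Lemma horner_revpoly_circle n F z : (size F <= n.+1)%N -> z * z^* = 1 ->
  (revpoly n F).[z] = z ^+ n * (F.[z])^*.
Proof.
move=> sF zz; have zc := unit_circle_inv zz.
have z0 := unit_circle_neq0 zz.
by rewrite horner_revpoly // zc invrK.
Qed.

Lemma popuc_size : size P = m.+2.
Proof.
have [mQ sQ] := Q_monic m.
have sXQ : size ('X * Q m) = m.+2.
  by rewrite mulrC size_mulX ?sQ // -size_poly_eq0 sQ.
rewrite size_polyDl ?sXQ // size_polyN mul_polyC ltnS.
by rewrite (leq_trans (size_scale_leq _ _)) // size_poly.
Qed.

(** The term ['X * Q m] pairs with ['X * G] as [Q m] does with [G]. For the reversed term,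
    conjugation on the circle exchanges roles: the pairing becomes that of the reversed [G], of
    degree below [m], with [Q m]. When [m = 0], [G] is zero. *)
Lemma popuc_orth G : (size G <= m)%N -> ip E P ('X * G) = 0.
Proof.
move=> sG; rewrite /P ipBl // ip_mulX opuc_orth // sub0r.
rewrite mul_polyC ipZl //; apply/eqP; rewrite oppr_eq0 mulf_eq0; apply/orP; right.
case: m sG => [|k] sG.
  by move: sG; rewrite leqn0 size_poly_eq0 => /eqP ->; rewrite mulr0 ip0r.
have [mQ sQ] := Q_monic k.+1.
rewrite (_ : ip _ _ _ = ip E (revpoly k G) (Q k.+1)).
  by rewrite -ipJ // opuc_orth ?conjC0 // size_poly.
apply: eq_ip => // z zz.
rewrite !horner_revpoly_circle ?sQ // hornerM hornerX rmorphM /= exprSr.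
by rewrite -[RHS]mulr1 -zz; ring.
Qed.

Lemma popuc_root_neq0 w : root P w -> w != 0.
Proof.
have [mQ sQ] := Q_monic m.
apply: contraTneq => ->; rewrite rootE /P hornerD hornerN !hornerM hornerX hornerC.
rewrite mul0r sub0r horner_coef0 coef_poly subn0.
have := mQ; rewrite monicE lead_coefE sQ /= => /eqP ->.
by rewrite conjC1 mulr1 oppr_eq0 conjC_eq0 -normr_eq0 b1 oner_eq0.
Qed.

(** Because [|b| = 1], reversing [P] in degree [m.+1] only multiplies it by [- b], so its zeros are
    symmetric under reflection in the circle. *)
Lemma popuc_root_inv w : root P w -> root P (w^*)^-1.
Proof.
move=> rw; have w0 := popuc_root_neq0 rw; have [mQ sQ] := Q_monic m.
have wc0 : w^* != 0 by rewrite conjC_eq0.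
have bb : b * b^* = 1 by rewrite -normCK b1 expr1n.
move: rw; rewrite !rootE /P !hornerD !hornerN !hornerM !hornerX !hornerC.
rewrite !horner_revpoly ?sQ // ?invr_eq0 //.
rewrite fmorphV /= conjCK invrK => /eqP/(canRL (addrK _)); rewrite add0r opprK.
move=> /(congr1 Num.conj); rewrite !rmorphM /= rmorphXn /= !conjCK => E1.
have -> : (Q m).[w]^* = b * w^* ^+ m * (Q m).[(w^*)^-1] / w^*.
  by apply: (mulfI wc0); rewrite E1; field.
have u0 : w^* ^+ m != 0 by rewrite expf_neq0.
rewrite exprVn; move: (w^* ^+ m) u0 ((Q m).[_]) => u u0 q.
have -> : (w^*)^-1 * q - b^* * (u^-1 * (b * u * q / w^*)) =
  (1 - b * b^*) * (q / w^*) by field; rewrite wc0 u0.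
by rewrite bb subrr mul0r.
Qed.

                                                                             
                                                                             
Lemma popuc_no_inverse_pair w T : w != 0 ->
  P != ('X - w%:P) * ('X - ((w^*)^-1)%:P) * T.
Proof.
move=> w0; have wc0 : w^* != 0 by rewrite conjC_eq0.
apply/eqP => PE; have T0 : T != 0.
  by apply: contra_eq_neq PE => ->; rewrite mulr0 -size_poly_eq0 popuc_size.
have sT : (size T <= m)%N.
  have := popuc_size; rewrite PE !size_mul ?mulf_neq0 ?polyXsubC_eq0 //.
  by rewrite !size_XsubC !addSn /= add0n => -[->].
have := popuc_orth sT.
rewrite (_ : ip _ _ _ = - (w^*)^-1 * ip E (('X - w%:P) * T) (('X - w%:P) * T)).
  move/eqP; rewrite mulf_eq0 oppr_eq0 invr_eq0 (negbTE wc0) /=.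
  by rewrite gt_eqF // ip_gt0 // mulf_neq0 // polyXsubC_eq0.
rewrite -ipZl // PE; apply: eq_ip => // z zz.
rewrite !(hornerM, hornerZ, hornerXsubC, hornerX) !rmorphM !rmorphB /=.
have zc : z^* = z^-1 by exact: unit_circle_inv.
have z0 := unit_circle_neq0 zz.
by rewrite zc; field; rewrite wc0 z0.
Qed.

(** A zero off the circle differs from its reflection, which is also a zero: a forbidden pair. *)
Lemma popuc_root_circle w : root P w -> `|w| = 1.
Proof.
move=> rw; have w0 := popuc_root_neq0 rw; have rw' := popuc_root_inv rw.
have wc0 : w^* != 0 by rewrite conjC_eq0.
move/factor_theorem: (rw) => [T PT].
case: (eqVneq w ((w^*)^-1)) => [ww|ww].
  have : w * w^* = 1 by rewrite {1}ww mulVf.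
  by rewrite -normCK => /eqP; rewrite sqrp_eq1 // => /eqP.
have /factor_theorem [S TS] : root T (w^*)^-1.
  move: rw'; rewrite PT rootM => /orP [//|].
  by rewrite root_XsubC eq_sym (negbTE ww).
have /eqP[] := popuc_no_inverse_pair S w0.
by rewrite PT TS; ring.
Qed.

(** A point of the circle is its own reflection, so a double zero is again a forbidden pair. *)
Lemma popuc_root_simple w : root P w -> P^`().[w] != 0.
Proof.
move=> rw; have w0 := popuc_root_neq0 rw.
have wc0 : w^* != 0 by rewrite conjC_eq0.
have ww : w * w^* = 1 by rewrite -normCK (popuc_root_circle rw) expr1n.
move/factor_theorem: (rw) => [T PT].
have -> : P^`().[w] = T.[w].
  rewrite PT derivM derivXsubC hornerD !hornerM hornerXsubC subrr.
  by rewrite mulr0 add0r hornerC mulr1.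
apply: contraT => /negPn /factor_theorem [S TS].
have /eqP[] := popuc_no_inverse_pair S w0.
have -> : (w^*)^-1 = w by rewrite -[LHS]mul1r -ww mulfK.
by rewrite PT TS; ring.
Qed.

End Popuc.

End OrthogonalPolynomials.

(** * Integration as a functional, and regularity in [t] of polynomial coefficients *)

Section MeasureFunctionals.
Variable R : realType.

Lemma bm_integrable (nu : {finite_measure set R -> \bar R}) (f : R -> R) : bm f ->
  nu.-integrable setT (EFin \o f).
Proof.
move=> [mf [C fC]]; apply: measurable_bounded_integrable => //.
  exact: fin_num_fun_lty.
by exists C; split; rewrite ?num_real // => y Cy x _; apply: le_trans (ltW Cy).
Qed.

Lemma Rintegral_fun_linear (nu : {finite_measure set R -> \bar R}) :
  fun_linear (Rintegral nu setT).
Proof.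
split=> [f g bf bg|c f bf]; first by rewrite RintegralD //; exact: bm_integrable.
by rewrite RintegralZl //; exact: bm_integrable.
Qed.

Lemma opuc_ip (nu : {finite_measure set R -> \bar R}) (Q : nat -> {poly R[i]}) :
  opuc nu Q -> [/\ forall n, Q n \is monic /\ size (Q n) = n.+1,
    forall n m, n != m -> ip (Rintegral nu setT) (Q n) (Q m) = 0 &
    forall n, ip (Rintegral nu setT) (Q n) (Q n) != 0].
Proof.
move=> [Q1 Q2 Q3]; split => // n; have := Q3 n.
by rewrite /ip; under eq_fun do rewrite normCK.
Qed.

End MeasureFunctionals.

Section RegularPolynomials.
Variables (R : realType) (U : set R).
Hypothesis oU : open U.
Implicit Types (F G : R -> {poly R[i]}).

Definition cC1_poly F := forall k, cC1 U (fun t => (F t)`_k).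

Lemma cC1_horner F (z : R -> R[i]) (N : nat) :
  (forall t, U t -> (size (F t) <= N)%N) -> cC1_poly F -> cC1 U z ->
  cC1 U (fun t => (F t).[z t]).
Proof.
move=> sF cF cz.
apply: (@eq_cC1 _ _ (fun t => \sum_(k < N) (F t)`_k * z t ^+ k)) => //.
  by move=> t Ut; rewrite (horner_coef_wide _ (sF t Ut)).
by apply: cC1_sum => k; apply: cC1M => //; apply: cC1X.
Qed.

Lemma cC1_poly_cst (p : {poly R[i]}) : cC1_poly (fun=> p).
Proof. by move=> k; apply: cC1_cst. Qed.

Lemma cC1_polyM F G : cC1_poly F -> cC1_poly G ->
  cC1_poly (fun t => F t * G t).
Proof.
move=> cF cG k; under [X in cC1 _ X]eq_fun do rewrite coefM.
by apply: cC1_sum => i; apply: cC1M.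
Qed.

                                                                 
(** Synthetic division: [G] is recovered from the top coefficient down by
    [G_k = F_(k+1) + w * G_(k+1)], starting from the zero coefficients at indices [N] and above. *)
Lemma cC1_poly_div F G (w : R -> R[i]) (N : nat) :
  (forall t, U t -> (size (G t) <= N)%N) ->
  (forall t, U t -> F t = ('X - (w t)%:P) * G t) ->
  cC1 U w -> cC1_poly F -> cC1_poly G.
Proof.
move=> sG FG cw cF.
suff H i k : (N <= k + i)%N -> cC1 U (fun t => (G t)`_k).
  by move=> k; apply: (H N); rewrite leq_addl.
elim: i k => [|i IH] k.
  rewrite addn0 => Nk; apply: (@eq_cC1 _ _ (fun=> 0)) => //; last exact: cC1_cst.
  by move=> t Ut; rewrite nth_default // (leq_trans (sG t Ut)).
rewrite addnS -addSn => /IH cG.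
apply: (@eq_cC1 _ _ (fun t => (F t)`_k.+1 + w t * (G t)`_k.+1)) => //.
  move=> t Ut; rewrite (FG t Ut) mulrBl coefB mulrC coefMX /= mul_polyC coefZ.
  by rewrite subrK.
by apply: cC1D => //; apply: cC1M.
Qed.

Section Moments.
Variables (E dE : R -> (R -> R) -> R).
Hypothesis linE : forall t, U t -> fun_linear (E t).
Hypothesis derE : forall t f, U t -> bm f ->
  is_derive t 1 (E^~ f) (dE t f) /\ {for t, continuous (dE^~ f)}.

Lemma cderiv_ip (p q : {poly R[i]}) t : U t ->
  cderiv (fun s => ip (E s) p q) t (ip (dE t) p q).
Proof.
by move=> Ut; have [b1 b2] := cbm_prod p q; split; apply: (derE Ut _).1.
Qed.

Lemma cC1_ip F G (M N : nat) :
  (forall t, U t -> (size (F t) <= M)%N) ->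
  (forall t, U t -> (size (G t) <= N)%N) ->
  cC1_poly F -> cC1_poly G -> cC1 U (fun t => ip (E t) (F t) (G t)).
Proof.
move=> sF sG cF cG.
apply: (@eq_cC1 _ _ (fun t => \sum_(j < M) \sum_(k < N)
   (F t)`_j * ((G t)`_k)^* * ip (E t) 'X^j 'X^k)) => //.
  by move=> t Ut; rewrite (ip_expand (linE Ut) (sF t Ut) (sG t Ut)).
apply: cC1_sum => j; apply: cC1_sum => k.
apply: cC1M; first by apply: cC1M => //; apply: cC1J.
exists (fun t => ip (dE t) 'X^j 'X^k) => t Ut; split; first exact: cderiv_ip.
by have [b1 b2] := cbm_prod ('X^j : {poly R[i]}) 'X^k; split; apply: (derE Ut _).2.
Qed.

Variables (Q : R -> nat -> {poly R[i]}).
Hypothesis Q_monic : forall t, U t -> forall n, Q t n \is monic /\ size (Q t n) = n.+1.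
Hypothesis Q_orth : forall t, U t -> forall n m, n != m -> ip (E t) (Q t n) (Q t m) = 0.
Hypothesis Q_neq0 : forall t, U t -> forall n, ip (E t) (Q t n) (Q t n) != 0.

(** Strong induction through [gram_schmidt]: only sums, products and quotients of regular functions
    occur, with denominators that do not vanish. *)
Lemma cC1_opuc m : cC1_poly (fun t => Q t m).
Proof.
have sQ n t : U t -> (size (Q t n) <= n.+1)%N by move=> Ut; rewrite (Q_monic Ut n).2.
elim/ltn_ind: m => m IH i.
apply: (@eq_cC1 _ _ (fun t => ('X^m : {poly R[i]})`_i -
  \sum_(k < m) ip (E t) 'X^m (Q t k) / ip (E t) (Q t k) (Q t k) * (Q t k)`_i)) => //.
  move=> t Ut; rewrite [in RHS](gram_schmidt (linE Ut) (Q_monic Ut) (Q_orth Ut)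
    (Q_neq0 Ut)).
  by rewrite coefB coef_sum; congr (_ - _); apply: eq_bigr => k _; rewrite coefZ.
apply: cC1B; first exact: cC1_cst.
apply: cC1_sum => k; have ck := IH k (ltn_ord k).
apply: cC1M; last exact: ck.
apply: cC1M.
  by apply: (@cC1_ip _ _ m.+1 k.+1) => //; [move=> t _; rewrite size_polyXn|
    exact: sQ|exact: cC1_poly_cst].
apply: cC1V; first by move=> t Ut; apply: Q_neq0.
by apply: (@cC1_ip _ _ k.+1 k.+1) => //; exact: sQ.
Qed.

Lemma cC1_revpoly m : cC1_poly (fun t => revpoly m (Q t m)).
Proof.
move=> k; under [X in cC1 _ X]eq_fun do rewrite coef_poly.
case: (ltnP k m.+1) => _; last exact: cC1_cst.
by apply: cC1J; apply: cC1_opuc.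
Qed.

Variables (m : nat) (b : R -> R[i]).

Lemma cC1_popuc : cC1 U b ->
  cC1_poly (fun t => 'X * Q t m - ((b t)^*)%:P * revpoly m (Q t m)).
Proof.
move=> cb k; under [X in cC1 _ X]eq_fun do rewrite coefB mul_polyC coefZ.
apply: cC1B; last by apply: cC1M; [apply: cC1J|apply: cC1_revpoly].
exact: (cC1_polyM (cC1_poly_cst 'X) (cC1_opuc m)).
Qed.

                                                        
(** A fixed zero [a] on the circle determines the parameter: [b^*] is [a * Q(a)] divided by the
    reversed polynomial at [a], whose modulus is that of [Q(a)], nonzero by [opuc_root_circle]. *)
Lemma cC1_popuc_parameter (a : R[i]) : `|a| = 1 ->
  (forall t, U t -> root ('X * Q t m - ((b t)^*)%:P * revpoly m (Q t m)) a) ->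
  cC1 U b.
Proof.
move=> a1 ra.
have aa : a * a^* = 1 by rewrite -normCK a1 expr1n.
have Qa0 t : U t -> (Q t m).[a] != 0.
  move=> Ut; exact: (opuc_root_circle (linE Ut) (Q_monic Ut) (Q_orth Ut)
    (Q_neq0 Ut) m a1).
have a0 : a != 0 by rewrite -normr_eq0 a1 oner_eq0.
have den0 t : U t -> a ^+ m * ((Q t m).[a])^* != 0.
  by move=> Ut; rewrite mulf_neq0 ?expf_neq0 // conjC_eq0 Qa0.
have cQa : cC1 U (fun t => (Q t m).[a]).
  apply: (@cC1_horner (fun t => Q t m) (fun=> a) m.+1); last exact: cC1_cst.
    by move=> t Ut; rewrite (Q_monic Ut m).2.
  exact: cC1_opuc.
apply: (@eq_cC1 _ _ (fun t => (a * (Q t m).[a] / (a ^+ m * ((Q t m).[a])^*))^*)) => //.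
  move=> t Ut; have := ra t Ut.
  rewrite rootE hornerD hornerN !hornerM hornerX hornerC.
  rewrite (horner_revpoly_circle _ aa) ?(Q_monic Ut m).2 //.
  by rewrite subr_eq0 => /eqP ->; rewrite mulfK ?den0 // conjCK.
apply: cC1J; apply: cC1M; first by apply: cC1M => //; apply: cC1_cst.
apply: cC1V => //; apply: cC1M; first exact: cC1_cst.
exact: cC1J.
Qed.

End Moments.

End RegularPolynomials.

                          

(** * Continuation of a simple zero of a regular family of polynomials *)

Section ZeroBranch.
Variable R : realType.

Definition disc_nbhs (c : R[i]) : set_system R[i] :=
  [set A | exists2 r : R, 0 < r & forall z, `|z - c| < r%:C -> A z].

#[local] Instance disc_nbhs_filter c : Filter (disc_nbhs c).
Proof.
split.
- by exists 1.
- move=> A B [r r0 rA] [s s0 sB]; exists (Num.min r s); first by rewrite lt_min r0.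
  move=> z zc; split; [apply: rA|apply: sB]; apply: lt_le_trans zc _.
    by rewrite lecR ge_min lexx.
  by rewrite lecR ge_min lexx orbT.
- by move=> A B AB [r r0 rA]; exists r => // z /rA /AB.
Qed.

Lemma normc_ge_Im (z : R[i]) : `|complex.Im z|%:C <= `|z|.
Proof.
rewrite normc_def lecR -sqrtr_sqr; apply: ler_wsqrtr.
by rewrite lerDr sqr_ge0.
Qed.

Lemma ccvg_of_norm (T : Type) (F : set_system T) (FF : Filter F)
  (f : T -> R[i]) (l : R[i]) :
  (forall e : R, 0 < e -> \forall x \near F, `|f x - l| < e%:C) -> ccvg F f l.
Proof.
move=> h; split; apply/cvgrPdist_lt => e e0; apply: filterS (h e e0) => x;
  rewrite distrC => fe; rewrite -ltcR; apply: le_lt_trans fe.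
  by rewrite -ReB; exact: normc_ge_Re.
by rewrite -ImB; exact: normc_ge_Im.
Qed.

Lemma ccvg_disc (c : R[i]) : ccvg (disc_nbhs c) id c.
Proof. by apply: ccvg_of_norm => e e0; exists e. Qed.

Lemma ccvg_comp (T S : Type) (F : set_system T) (G : set_system S) (h : T -> S)
  (f : S -> R[i]) (l : R[i]) : h @ F --> G -> ccvg G f l ->
  ccvg F (fun x => f (h x)) l.
Proof.
by move=> hFG [f1 f2]; split;
  [exact: (cvg_comp _ _ hFG f1)|exact: (cvg_comp _ _ hFG f2)].
Qed.

Definition diff_quot (N : nat) (p : {poly R[i]}) (z w : R[i]) : R[i] :=
  \sum_(k < N) p`_k * \sum_(i < k) z ^+ (k.-1 - i) * w ^+ i.

Lemma diff_quotE N (p : {poly R[i]}) z w : (size p <= N)%N ->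
  p.[z] - p.[w] = (z - w) * diff_quot N p z w.
Proof.
move=> sp; rewrite !(horner_coef_wide _ sp) -sumrB mulr_sumr.
by apply: eq_bigr => k _; rewrite -mulrBr subrXX mulrCA.
Qed.

Lemma diff_quot_deriv N (p : {poly R[i]}) z : (size p <= N)%N ->
  diff_quot N p z z = p^`().[z].
Proof.
move=> sp; have {2}-> : p = \sum_(k < N) p`_k *: 'X^k.
  rewrite -poly_def; apply/polyP => i; rewrite coef_poly.
  by case: ltnP => // Ni; rewrite nth_default // (leq_trans sp).
rewrite raddf_sum /= horner_sum; apply: eq_bigr => k _.
rewrite derivZ derivXn hornerZ hornerMn hornerXn; congr (_ * _).
rewrite (eq_bigr (fun=> z ^+ k.-1)) ?sumr_const ?card_ord // => i _.
by rewrite -exprD subnK // -ltnS (ltn_predK (ltn_ord i)).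
Qed.

Lemma ccvg_diff_quot (T : Type) (F : set_system T) (FF : Filter F) N
  (p : T -> {poly R[i]}) (z w : T -> R[i]) (p0 : {poly R[i]}) (z0 w0 : R[i]) :
  (forall k, ccvg F (fun x => (p x)`_k) p0`_k) -> ccvg F z z0 -> ccvg F w w0 ->
  ccvg F (fun x => diff_quot N (p x) (z x) (w x)) (diff_quot N p0 z0 w0).
Proof.
move=> cp cz cw; apply: ccvg_sum => k; apply: ccvgM => //.
by apply: ccvg_sum => i; apply: ccvgM; apply: ccvgX.
Qed.

Variables (U : set R) (P : R -> {poly R[i]}) (n : nat).
Hypothesis oU : open U.
Hypothesis cP : cC1_poly U P.
Hypothesis P_monic : forall t, U t -> P t \is monic.
Hypothesis P_size : forall t, U t -> size (P t) = n.+2.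

Let sP t : U t -> (size (P t) <= n.+2)%N. Proof. by move=> /P_size ->. Qed.

(** A monic polynomial at [w] has modulus the product of the distances from [w] to its [n.+1] roots.
    Were all of them at least [e], it would be at least [e ^+ n.+1], whereas [(P s).[w]] tends to
    [(P t).[w] = 0]. *)
Lemma root_near t w (e : R) : U t -> root (P t) w -> 0 < e ->
  \forall s \near t, exists2 z, root (P s) z & `|z - w| < e%:C.
Proof.
move=> Ut /rootP rw e0.
have ce : cC1 U (fun s => (P s).[w]).
  by apply: (@cC1_horner _ _ oU P (fun=> w) n.+2) => //; exact: cC1_cst.
have e1 : 0 < e ^+ n.+1 by rewrite exprn_gt0.
have n1 := ccvg_norm_lt e1 (cC1_ccvg ce Ut).
have n2 := open_nbhs_nbhs (conj oU Ut).
near=> s; have Us : U s by near: s; exact: n2.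
have Pw : `|(P s).[w] - (P t).[w]| < (e ^+ n.+1)%:C by near: s; exact: n1.
rewrite rw subr0 in Pw.
have [r rE] := closed_field_poly_normal (P s).
move: rE; rewrite (monicP (P_monic Us)) scale1r => rE.
have sr : size r = n.+1.
  by have := P_size Us; rewrite rE size_prod_XsubC => -[].
apply: contrapT => nex.
have far z : z \in r -> e%:C <= `|w - z|.
  move=> zr; rewrite real_leNgt ?normr_real //; last first.
    by rewrite complex_real.
  apply/negP => we; apply: nex; exists z; last by rewrite distrC.
  by rewrite rE root_prod_XsubC.
have : (e ^+ n.+1)%:C <= `|(P s).[w]|.
  rewrite rE horner_prod normr_prod rmorphXn /= -sr.
  elim: r far {rE sr} => [|z r IH] far; first by rewrite big_nil.
  have e0' : 0 <= e%:C by rewrite ler0c ltW.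
  rewrite big_cons /= exprS; apply: ler_pM => //; first by rewrite exprn_ge0.
  - by rewrite hornerXsubC far // mem_head.
  - by apply: IH => y yr; apply: far; rewrite inE yr orbT.
by move=> /le_lt_trans /(_ Pw); rewrite ltxx.
Unshelve. all: by end_near.
Qed.

Section Branch.
Variables (zeta : R -> R[i]) (c : R[i]) (delta : R).
Hypothesis zeta_root : forall t, U t -> root (P t) (zeta t).
Hypothesis zeta_disc : forall t, U t -> `|zeta t - c| < delta%:C.
Hypothesis zeta_unique : forall t z, U t -> root (P t) z -> `|z - c| < delta%:C ->
  z = zeta t.
Hypothesis deriv_neq0 : forall t, U t -> (P t)^`().[zeta t] != 0.

Lemma branch_continuous s : U s -> ccvg (nbhs s) zeta (zeta s).
Proof.
move=> Us; apply: ccvg_of_norm => e e0.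
have [r rE] : exists r : R, `|zeta s - c| = r%:C by rewrite normc_def; eexists.
have rd : r < delta by rewrite -ltcR -rE zeta_disc.
(* The slack [delta - r] keeps a root close to [zeta s] inside the disc about [c], where uniqueness
   identifies it with [zeta t]. *)
have m0 : 0 < Num.min e (delta - r) by rewrite lt_min e0 subr_gt0.
have n1 := root_near Us (zeta_root Us) m0.
have n2 := open_nbhs_nbhs (conj oU Us).
near=> t; have Ut : U t by near: t; exact: n2.
have [z rz zs] : exists2 z, root (P t) z & `|z - zeta s| < (Num.min e (delta - r))%:C.
  by near: t; exact: n1.
rewrite -(zeta_unique Ut rz).
  by apply: lt_le_trans zs _; rewrite lecR ge_min lexx.
rewrite -(subrK (zeta s) z) -addrA (le_lt_trans (ler_normD _ _)) // rE.
rewrite -ltrBrDr (lt_le_trans zs) // -raddfB lecR ge_min lexx orbT.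
Unshelve. all: by end_near.
Qed.

(** Implicit differentiation: the derivative is minus the [t]-derivative of [P] at the root divided
    by the [z]-derivative there. Continuity of the branch makes this formula continuous. *)
Lemma cC1_branch : cC1 U zeta.
Proof.
have /choice [p' dp] : forall k, exists g, forall t, U t ->
    cderiv (fun t => (P t)`_k) t (g t) /\ ccvg (nbhs t) g (g t) by exact: cP.
exists (fun s => - (\sum_(k < n.+2) p' k s * zeta s ^+ k) /
                 (P s)^`().[zeta s]) => s Us; split; last first.
  have -> : (P s)^`().[zeta s] = diff_quot n.+2 (P s) (zeta s) (zeta s).
    by rewrite diff_quot_deriv // sP.
  have c1 : ccvg (nbhs s) (fun t => - (\sum_(k < n.+2) p' k t * zeta t ^+ k) /
      diff_quot n.+2 (P t) (zeta t) (zeta t))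
     (- (\sum_(k < n.+2) p' k s * zeta s ^+ k) /
      diff_quot n.+2 (P s) (zeta s) (zeta s)).
    have cz := branch_continuous Us.
    apply: ccvgM.
      apply: ccvgN; apply: ccvg_sum => k; apply: ccvgM; last exact: ccvgX.
      exact: (dp k s Us).2.
    apply: ccvgV; first by rewrite diff_quot_deriv ?sP // deriv_neq0.
    by apply: ccvg_diff_quot => // k; exact: (cC1_ccvg (cP k) Us).
  have n2 := open_nbhs_nbhs (conj oU Us).
  case: c1 => c1 c2; split.
  - apply: cvg_trans c1; apply: near_eq_cvg; apply: filterS n2 => t Ut.
    by rewrite diff_quot_deriv // sP.
  - apply: cvg_trans c2; apply: near_eq_cvg; apply: filterS n2 => t Ut.
    by rewrite diff_quot_deriv // sP.
pose L := \sum_(k < n.+2) p' k s * zeta s ^+ k.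
have : cderiv (fun t => (P t).[zeta s]) s L.
  apply: (@eq_cderiv _ (fun t => \sum_(k < n.+2) (P t)`_k * zeta s ^+ k)).
    have n2 := open_nbhs_nbhs (conj oU Us).
    by apply: filterS n2 => t Ut; rewrite (horner_coef_wide _ (sP Ut)).
  apply: cderiv_sum => k.
  have := cderivM (dp k s Us).1 (cderiv_cst (zeta s ^+ k) s).
  by rewrite mulr0 addr0.
move=> /cderiv_caratheodory [q [q1 q2 q3]].
have Ds : diff_quot n.+2 (P s) (zeta s) (zeta s) = (P s)^`().[zeta s].
  by rewrite diff_quot_deriv // sP.
pose D t := diff_quot n.+2 (P t) (zeta t) (zeta s).
have cD : ccvg (nbhs s) D (D s).
  apply: ccvg_diff_quot => //; [|exact: branch_continuous|exact: ccvg_cst].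
  by move=> k; exact: (cC1_ccvg (cP k) Us).
have D0 : D s != 0 by rewrite /D Ds deriv_neq0.
apply: (@eq_cderiv _ (fun t => zeta s + (t - s)%:C * (- q t / D t))); last first.
  apply/cderiv_caratheodory; exists (fun t => - q t / D t); split.
  - by move=> t; rewrite subrr mul0r addr0 addrC addKr.
  - by apply: ccvgM; [exact: ccvgN|exact: ccvgV].
  - by rewrite q3 /D Ds.
have n1 := ccvg_neq0 D0 cD.
have n2 := open_nbhs_nbhs (conj oU Us).
near=> t; have Ut : U t by near: t; exact: n2.
have Dt : D t != 0 by near: t; exact: n1.
have E1 : (P t).[zeta s] = (t - s)%:C * q t.
  by rewrite -q1 (rootP (zeta_root Us)) subr0.
(* Since [P t] vanishes at [zeta t], [(zeta t - zeta s) * D t] equals [- (P t).[zeta s]], that is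
   [- (t - s) * q t]; near [s] one may divide by [D t]. *)
have := diff_quotE (zeta t) (zeta s) (sP Ut).
rewrite (rootP (zeta_root Ut)) E1 sub0r -/(D t) => E2.
rewrite mulrA mulrN E2 mulfK // addrC subrK.
Unshelve. all: by end_near.
Qed.

End Branch.

Hypothesis P_circle : forall t z, U t -> root (P t) z -> `|z| = 1.
Hypothesis P_simple : forall t z, U t -> root (P t) z -> (P t)^`().[z] != 0.

                                                                              
                                          
(** The divided difference at [(t0, c, c)] is the derivative at a simple root, hence nonzero, and
    stays so nearby. Two roots [z] and [w] of the same [P t] make [z - w] times it vanish. *)
Lemma roots_separated t0 c : U t0 -> root (P t0) c ->
  exists2 d : R, 0 < d & \forall t \near t0, forall z w, U t ->
    root (P t) z -> root (P t) w -> `|z - c| < d%:C -> `|w - c| < d%:C -> z = w.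
Proof.
move=> Ut0 rc.
pose G := filter_prod (nbhs t0) (filter_prod (disc_nbhs c) (disc_nbhs c)).
have FG : Filter G by apply: filter_prod_filter.
have cf : ccvg G (fun x => diff_quot n.+2 (P x.1) x.2.1 x.2.2)
                 (diff_quot n.+2 (P t0) c c).
  have c2 : snd @ G --> filter_prod (disc_nbhs c) (disc_nbhs c) by exact: cvg_snd.
  apply: ccvg_diff_quot.
  - by move=> k; apply: (ccvg_comp _ (cC1_ccvg (cP k) Ut0)); exact: cvg_fst.
  - by apply: (ccvg_comp _ (ccvg_disc c)); apply: (cvg_comp _ _ c2); exact: cvg_fst.
  - by apply: (ccvg_comp _ (ccvg_disc c)); apply: (cvg_comp _ _ c2); exact: cvg_snd.
have D0 : diff_quot n.+2 (P t0) c c != 0.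
  by rewrite diff_quot_deriv ?sP // P_simple.
have [[A B] /= [nA [[B1 B2] /= [[r1 r10 rB1] [r2 r20 rB2]] B12]] AB] :=
  ccvg_neq0 D0 cf.
exists (Num.min r1 r2); first by rewrite lt_min r10.
apply: filterS nA => t At z w Ut rz rw zc wc.
have := AB (t, (z, w)) (conj At (B12 (z, w) (conj _ _))) => /= nz.
have {nz} : diff_quot n.+2 (P t) z w != 0.
  apply: nz => /=; [apply: rB1|apply: rB2].
    by apply: lt_le_trans zc _; rewrite lecR ge_min lexx.
  by apply: lt_le_trans wc _; rewrite lecR ge_min lexx orbT.
have := diff_quotE z w (sP Ut); rewrite (rootP rz) (rootP rw) subrr.
by move/esym/eqP; rewrite mulf_eq0 => /orP [|->//]; rewrite subr_eq0 => /eqP.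
Qed.

End ZeroBranch.

Lemma exists_zero_branch (R : realType) (U : set R) (P : R -> {poly R[i]})
  (n : nat) (t0 : R) (c : R[i]) :
  open U -> cC1_poly U P ->
  (forall t, U t -> P t \is monic) ->
  (forall t, U t -> size (P t) = n.+2) ->
  (forall t z, U t -> root (P t) z -> `|z| = 1) ->
  (forall t z, U t -> root (P t) z -> (P t)^`().[z] != 0) ->
  U t0 -> root (P t0) c ->
  exists eps delta zeta, zero_branch P U c t0 eps delta zeta.
Proof.
move=> oU cP P_monic P_size P_circle P_simple Ut0 rc.
have [d d0 sep] := roots_separated cP P_size P_simple Ut0 rc.
have near_root := root_near oU cP P_monic P_size Ut0 rc d0.
have nU := open_nbhs_nbhs (conj oU Ut0).
have : \forall t \near t0, [/\ U t, exists2 z, root (P t) z & `|z - c| < d%:C &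
   forall z w, root (P t) z -> root (P t) w ->
     `|z - c| < d%:C -> `|w - c| < d%:C -> z = w].
  near=> t; have Ut : U t by near: t; exact: nU.
  split => //; first by near: t; exact: near_root.
  move=> z w rz rw; move: (Ut) rz rw; move: z w; near: t.
  by apply: filterS sep => t h z w Ut; exact: h.
move=> /nbhs_ballP [e /= e0 eb].
(* The default [0] is never taken on the ball, where [eb] supplies a root. *)
pose zeta t := xget 0 [set z | root (P t) z /\ `|z - c| < d%:C].
have zetaP t : ball t0 e t -> root (P t) (zeta t) /\ `|zeta t - c| < d%:C.
  by move=> /eb [_ [z rz zc] _]; rewrite /zeta; case: xgetP => [y _ //|/(_ z)[]].
have bU t : ball t0 e t -> U t by move=> /eb [].
have zeta_unique t z : ball t0 e t -> root (P t) z -> `|z - c| < d%:C -> z = zeta t.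
  move=> bt rz zc; have [rt ct] := zetaP t bt; have [_ _ u] := eb t bt.
  exact: u.
exists e, d, zeta; split => //.
  move=> t bt; have [rt ct] := zetaP t bt; split => //.
    by split => //; apply: P_circle rt; exact: bU.
  by move=> z [_ zc] rz; apply: zeta_unique.
have ob : open (ball t0 e) by exact: ball_open.
apply/(C1c_onP _ ob).
apply: (cC1_branch (n := n) ob _ _ _ (c := c) (delta := d)).
- by move=> k; apply: cC1_sub (cP k).
- by move=> t /bU /P_monic.
- by move=> t /bU /P_size.
- by move=> t /zetaP [].
- by move=> t /zetaP [].
- by move=> t z bt; apply: zeta_unique.
- by move=> t bt; apply: P_simple; [exact: bU|exact: (zetaP t bt).1].
Unshelve. all: by end_near.
Qed.

                           

(** * Velocity of a moving zero in the presence of a fixed zero [a] *)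

Section ZeroVelocity.
Variables (R : realType) (U : set R).
Hypothesis oU : open U.
Variables E dE : R -> (R -> R) -> R.
Hypothesis linE : forall t, U t -> fun_linear (E t).
Hypothesis lindE : forall t, U t -> fun_linear (dE t).
Hypothesis derE : forall t f, U t -> bm f ->
  is_derive t 1 (E^~ f) (dE t f) /\ {for t, continuous (dE^~ f)}.
Variables (Q : R -> nat -> {poly R[i]}).
Hypothesis Q_monic : forall t, U t -> forall n, Q t n \is monic /\ size (Q t n) = n.+1.
Hypothesis Q_orth : forall t, U t -> forall n m, n != m -> ip (E t) (Q t n) (Q t m) = 0.
Hypothesis Q_neq0 : forall t, U t -> forall n, ip (E t) (Q t n) (Q t n) != 0.
Variables (m : nat) (b : R -> R[i]) (P : R -> {poly R[i]}).
Hypothesis P_def : forall t, U t ->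
  P t = 'X * Q t m - ((b t)^*)%:P * revpoly m (Q t m).
Hypothesis cP : cC1_poly U P.
Variables (a : R[i]) (zeta : R -> R[i]).
Hypothesis a1 : `|a| = 1.
Hypothesis P_a : forall t, U t -> root (P t) a.
Hypothesis P_zeta : forall t, U t -> root (P t) (zeta t).
Hypothesis zeta_a : forall t, U t -> zeta t != a.
Hypothesis c_zeta : cC1 U zeta.

(** Both Euclidean quotients are exact for [t] in [U]; the second is because [zeta t] is a root
    other than [a]. *)
Definition cofactor_poly t := (P t %/ ('X - a%:P)) %/ ('X - (zeta t)%:P).
Local Notation T := cofactor_poly.

Lemma popuc_factor t : U t -> P t = ('X - a%:P) * (('X - (zeta t)%:P) * T t).
Proof.
move=> Ut; have /factor_theorem [S PS] := P_a Ut.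
have Sz : root S (zeta t).
  have := P_zeta Ut; rewrite PS rootM => /orP [//|].
  by rewrite root_XsubC (negbTE (zeta_a Ut)).
rewrite /T PS mulpK ?polyXsubC_eq0 // mulrC; congr (_ * _).
have /factor_theorem [V ->] := Sz.
by rewrite mulpK ?polyXsubC_eq0 // mulrC.
Qed.

Lemma size_popuc t : U t -> size (P t) = m.+2.
Proof. by move=> Ut; rewrite P_def // (popuc_size (Q_monic Ut)). Qed.

Lemma size_cofactor t : U t -> size (T t) = m.
Proof.
move=> Ut; have T0 : T t != 0.
  apply/eqP => T0; have := size_popuc Ut.
  by rewrite (popuc_factor Ut) T0 !mulr0 size_poly0.
have := size_popuc Ut; rewrite (popuc_factor Ut).
by rewrite !size_mul ?mulf_neq0 ?polyXsubC_eq0 // !size_XsubC !addSn !add0n /= => -[].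
Qed.

Let sT t : U t -> (size (T t) <= m)%N.
Proof. by move=> /size_cofactor ->. Qed.

Lemma cC1_cofactor : cC1_poly U T.
Proof.
apply: (@cC1_poly_div _ _ oU (fun t => ('X - (zeta t)%:P) * T t) _ zeta m) => //.
apply: (@cC1_poly_div _ _ oU P _ (fun=> a) m.+1) => //.
- move=> t Ut; rewrite (leq_trans (size_mul_leq _ _)) // size_XsubC /= ltnS.
  exact: sT.
- exact: popuc_factor.
- exact: cC1_cst.
Qed.

Variable s : R.
Hypothesis Us : U s.

Let F : {poly R[i]} := ('X - a%:P) * ('X - (zeta s)%:P).

Let orthP t (G : {poly R[i]}) : U t -> (size G <= m)%N -> ip (E t) (P t) ('X * G) = 0.
Proof.
move=> Ut sG; rewrite P_def //.
exact: (popuc_orth (linE Ut) (Q_monic Ut) (Q_orth Ut) (Q_neq0 Ut)).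
Qed.

Lemma zeta_norm1 t : (forall f, bm f -> (forall x, 0 <= f x) -> 0 <= E t f) ->
  `|b t| = 1 -> U t -> `|zeta t| = 1.
Proof.
move=> E0 b1 Ut; have := P_zeta Ut; rewrite P_def //.
exact: (popuc_root_circle (linE Ut) E0 (Q_monic Ut) (Q_orth Ut) (Q_neq0 Ut)).
Qed.

Hypothesis zeta1 : `|zeta s| = 1.

(** For [z] and [a] on the circle, [z - a] is [- a * z] times its own conjugate, and likewise at
    [zeta s]. So [F] equals [a * zeta s * z ^+ 2] times its conjugate, which completes [T s] to
    [P s] in the second argument, and [popuc_orth] applies. *)
Let moment0 k : (k < m)%N -> ip (E s) (F * 'X^k) ('X * T s) = 0.
Proof.
move=> km; have aa : a * a^* = 1 by rewrite -normCK a1 expr1n.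
have zz1 : zeta s * (zeta s)^* = 1 by rewrite -normCK zeta1 expr1n.
rewrite (_ : ip _ _ _ = a * zeta s * ip (E s) ('X * 'X^k) (P s)).
  by rewrite -(ipJ (linE Us)) orthP ?conjC0 ?mulr0 // size_polyXn.
rewrite -(ipZl (linE Us)); apply: eq_ip => z zz.
rewrite (popuc_factor Us) /F.
rewrite !(hornerM, hornerZ, hornerXsubC, hornerX, hornerXn) !rmorphM !rmorphB /=.
have a0 := unit_circle_neq0 aa; have zeta0 := unit_circle_neq0 zz1.
have z0 := unit_circle_neq0 zz.
rewrite (unit_circle_inv aa) (unit_circle_inv zz) (unit_circle_inv zz1).
by field; rewrite a0 zeta0 z0.
Qed.

                                                                                
                                                                                
                                           
(** The pairing [X t] of [F * T t] with ['X * T s] under [E t] is differentiated at [s] in two ways: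
    through the motion of the zero ([d1]) and through the motion of the measure ([d2]). *)
Lemma zero_velocity l : cderiv zeta s l ->
  l * ip (E s) (('X - a%:P) * T s) ('X * T s) = ip (dE s) (F * T s) ('X * T s).
Proof.
move=> dz.
pose X t := ip (E t) (F * T t) ('X * T s).
pose A t := ip (E t) (('X - a%:P) * T t) ('X * T s).
(* [F * T t] differs from [P t] by [(zeta t - zeta s)] times [('X - a%:P) * T t], and [P t] is
   orthogonal to ['X * T s] under [E t]. *)
have XA t : U t -> X t = (zeta t - zeta s) * A t.
  move=> Ut; have -> : X t =
      ip (E t) (P t + (zeta t - zeta s) *: (('X - a%:P) * T t)) ('X * T s).
    congr ip; rewrite (popuc_factor Ut) /F -mul_polyC polyCB; ring.
  by rewrite (ipDl (linE Ut)) (ipZl (linE Ut)) orthP ?sT // add0r.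
have cA : cC1 U A.
  apply: (cC1_ip oU linE derE (M := m.+1) (N := m.+1)).
  - move=> t Ut; rewrite (leq_trans (size_mul_leq _ _)) // size_XsubC /= ltnS.
    exact: sT.
  - move=> t Ut; rewrite mulrC (leq_trans (size_polyMleq _ _)) // size_polyX addn2 /= ltnS.
    exact: sT.
  - by apply: cC1_polyM; [exact: cC1_poly_cst|exact: cC1_cofactor].
  - exact: cC1_poly_cst.
have d1 : cderiv X s (l * A s).
  apply: (@eq_cderiv _ (fun t => (zeta t - zeta s) * A t)).
    by apply: filterS (open_nbhs_nbhs (conj oU Us)) => t /XA.
  have [A' dA] := cA; have [dAs _] := dA s Us.
  have := cderivM (cderivD dz (cderiv_cst (- zeta s) s)) dAs.
  by rewrite subrr mul0r !addr0.
have /choice [T' dT] : forall k, exists g, forall t, U t ->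
    cderiv (fun t => (T t)`_k) t (g t) /\ ccvg (nbhs t) g (g t) by exact: cC1_cofactor.
have FT (e : (R -> R) -> R) (p : {poly R[i]}) : fun_linear e -> (size p <= m)%N ->
    ip e (F * p) ('X * T s) = \sum_(k < m) p`_k * ip e (F * 'X^k) ('X * T s).
  move=> le sp; have {1}-> : p = \sum_(k < m) p`_k *: 'X^k.
    rewrite -poly_def; apply/polyP => i; rewrite coef_poly.
    by case: ltnP => // mi; rewrite nth_default // (leq_trans sp).
  rewrite mulr_sumr (ip_suml le); apply: eq_bigr => k _.
  by rewrite -scalerAr (ipZl le).
(* After expanding [T t] in powers, each derivative of a coefficient multiplies a moment that
   vanishes at [s] by [moment0]; only the derivatives of the moments remain. *)
have d2 : cderiv X s (ip (dE s) (F * T s) ('X * T s)).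
  apply: (@eq_cderiv _ (fun t =>
    \sum_(k < m) (T t)`_k * ip (E t) (F * 'X^k) ('X * T s))).
    apply: filterS (open_nbhs_nbhs (conj oU Us)) => t Ut.
    by rewrite /X (FT (E t)) ?sT //; exact: linE.
  rewrite FT ?sT //; last exact: lindE.
  apply: cderiv_sum => k.
  have := cderivM (dT k s Us).1 (cderiv_ip derE (F * 'X^k) ('X * T s) Us).
  by rewrite moment0 // mulr0 add0r.
exact: cderiv_unique d1 d2.
Qed.

(** Orthogonality of [P s = ('X - zeta s) * G] to ['X * T s] gives
    [ip G (T s) = zeta s * ip G ('X * T s)]; expanding the second [G] in [ip G G] then leaves a
    single pairing. *)
Lemma cofactor_norm : a * ip (E s) (('X - a%:P) * T s) (('X - a%:P) * T s) =
  (a - zeta s) * ip (E s) (('X - a%:P) * T s) ('X * T s).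
Proof.
have aa : a * a^* = 1 by rewrite -normCK a1 expr1n.
set G := ('X - a%:P) * T s.
have E1 : ip (E s) G G = ip (E s) G ('X * T s) - a^* * ip (E s) G (T s).
  rewrite {2}/G mulrBl mul_polyC -scaleNr (ipDr (linE Us)) (ipZr (linE Us)).
  by rewrite rmorphN mulNr.
have E2 : ip (E s) G (T s) = zeta s * ip (E s) G ('X * T s).
  have := orthP Us (sT Us); have -> : P s = 'X * G + (- zeta s) *: G.
    by rewrite (popuc_factor Us) /G -mul_polyC polyCN; ring.
  rewrite (ipDl (linE Us)) (ipZl (linE Us)) (ip_mulX (E s)) mulNr.
  by move/eqP; rewrite subr_eq0 => /eqP.
rewrite E1 E2 mulrBr mulrBl; congr (_ - _).
by rewrite !mulrA aa mul1r.
Qed.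

Lemma zero_velocity_norm l : cderiv zeta s l ->
  l * a * ip (E s) (('X - a%:P) * T s) (('X - a%:P) * T s) =
  (a - zeta s) * ip (dE s) (('X - a%:P) * ('X - (zeta s)%:P) * T s) ('X * T s).
Proof.
by move=> /zero_velocity; rewrite -/F => <-; rewrite -mulrA cofactor_norm; ring.
Qed.

End ZeroVelocity.

(** * Chords of the circle and a differentiable argument for the branch *)

Section Cis.
Variable R : realType.
Implicit Types x y : R.

Lemma cisD x y : cis (x + y) = cis x * cis y.
Proof.
apply/eqP; rewrite eq_complex ReM ImM /= cosD sinD.
by apply/andP; split; apply/eqP; ring.
Qed.

Lemma cisN x : cis (- x) = (cis x)^*.
Proof. by apply/eqP; rewrite eq_complex ReJ ImJ /= cosN sinN !eqxx. Qed.

Lemma cisB x y : cis x - cis y =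
  (0 +i* (2 * sin ((x - y) / 2))) * cis ((x + y) / 2).
Proof.
pose h := (x + y) / 2; pose k := (x - y) / 2.
have hx : x = h + k by rewrite /h /k; field.
have hy : y = h - k by rewrite /h /k; field.
rewrite -/h -/k hx hy; apply/eqP; rewrite eq_complex ReM ImM ReB ImB /=.
rewrite !cosD !sinD cosN sinN.
by apply/andP; split; apply/eqP; ring.
Qed.

Lemma norm_cis x : `|cis x| = 1.
Proof.
by have := cis_norm x; rewrite -normCK => /eqP; rewrite sqrp_eq1 // => /eqP.
Qed.

(** Each chord is [2i] times a sine times the phase of the half-sum, by [cisB]; the parts of these
    phases depending on [theta] cancel against the conjugate factor. *)
Lemma cis_kernel (theta theta0 phi : R) :
  (cis theta - cis theta0) * (cis theta - cis phi) * (cis theta)^* =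
  (- 4 * (sin ((theta - theta0) / 2) * sin ((theta - phi) / 2)))%:C *
    cis ((theta0 + phi) / 2).
Proof.
rewrite !cisB -cisN.
have -> : cis ((theta0 + phi) / 2) =
    cis ((theta + theta0) / 2) * cis ((theta + phi) / 2) * cis (- theta).
  by rewrite -!cisD; congr cis; field.
set p := sin _; set q := sin _.
move: (cis _) (cis _) (cis _) => u v w.
have -> : (- 4 * (p * q))%:C = (0 +i* (2 * p)) * (0 +i* (2 * q)).
  by apply/eqP; rewrite eq_complex ReM ImM /=; apply/andP; split; apply/eqP; ring.
by ring.
Qed.

Lemma cderiv_cis (phi : R -> R) (t l : R) : is_derive t 1 phi l ->
  cderiv (fun s => cis (phi s)) t ((0 +i* l) * cis (phi t)).
Proof.
move=> dl; split; rewrite ?ReM ?ImM /=.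
- apply: (is_derive_eq (is_derive1_comp (is_derive_cos (phi t)) dl)).
  by ring.
- apply: (is_derive_eq (is_derive1_comp (is_derive_sin (phi t)) dl)).
  by ring.
Qed.

(** Half-angle formula for the principal argument of [- (x +i* y)], valid away from [-1], that is
    for [x != 1]. *)
Lemma cis_double_atan (x y : R) : x ^+ 2 + y ^+ 2 = 1 -> x != 1 ->
  cis (2 * atan (- y / (1 - x))) = (- x) +i* (- y).
Proof.
move=> xy x1; have x10 : 1 - x != 0 by rewrite subr_eq0 eq_sym.
set A := atan _; have cA : 0 < cos A.
  by apply: cos_gt0_pihalf; rewrite atan_gtNpi2 atan_ltpi2.
have cA0 : cos A != 0 by rewrite gt_eqF.
have tA : sin A = (- y / (1 - x)) * cos A.
  by have := atanK (- y / (1 - x)); rewrite -/A /tan => <-; rewrite divfK.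
have yy : y ^+ 2 = (1 - x) * (1 + x) by lra.
have c2 : cos A ^+ 2 = (1 - x) / 2.
  have := cos2Dsin2 A; rewrite tA => h.
  have : cos A ^+ 2 * ((1 - x) ^+ 2 + y ^+ 2) = (1 - x) ^+ 2.
    transitivity ((cos A ^+ 2 + (- y / (1 - x) * cos A) ^+ 2) * (1 - x) ^+ 2).
      by field.
    by rewrite h mul1r.
  rewrite yy (_ : (1 - x) ^+ 2 + (1 - x) * (1 + x) = 2 * (1 - x)); last by ring.
  by move=> h2; apply: (mulIf x10); apply: (mulIf (_ : (2 : R) != 0)) => //;
    rewrite -mulrA [_ * 2]mulrC h2; field.
rewrite mulr_natl /cis sin_mulr2n cos_mulr2n; congr (_ +i* _).
  by rewrite c2; field.
rewrite tA mulrCA -expr2 c2; field; exact: x10.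
Qed.

(** The quotient [u] of [zeta] by [cis theta0] avoids [1], so [- u] has a principal argument
    strictly between [- pi] and [pi], differentiable through [atan]. Adding [theta0 + pi] puts it
    inside the open period. *)
Lemma cis_lift (U : set R) (zeta : R -> R[i]) (theta0 : R) :
  cC1 U zeta -> (forall t, U t -> `|zeta t| = 1) ->
  (forall t, U t -> zeta t != cis theta0) ->
  exists phi : R -> R, forall t, U t ->
    [/\ zeta t = cis (phi t), theta0 < phi t < theta0 + 2 * pi & derivable phi t 1].
Proof.
move=> [zeta' dz] z1 za.
pose u t := zeta t * (cis theta0)^*.
have uE t : zeta t = cis theta0 * u t.
  by rewrite /u mulrCA -normCK norm_cis expr1n mulr1.
pose x t := complex.Re (u t); pose y t := complex.Im (u t).
have xy t : U t -> x t ^+ 2 + y t ^+ 2 = 1.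
  move=> Ut; apply: complexI; rewrite add_Re2_Im2 /u normrM norm_conjC norm_cis.
  by rewrite z1 // mulr1 expr1n.
have x1 t : U t -> x t != 1.
  move=> Ut; apply: contra_neq (za t Ut) => xt1; rewrite uE.
  have y0 : y t = 0.
    have := xy t Ut; rewrite xt1 expr1n => /eqP; rewrite -subr_eq0 addrC addrA addNr add0r.
    by rewrite sqrf_eq0 => /eqP.
  have -> : u t = 1 by apply/eqP; rewrite eq_complex -/(x t) -/(y t) xt1 y0 !eqxx.
  by rewrite mulr1.
exists (fun t => theta0 + pi + 2 * atan (- y t / (1 - x t))) => t Ut; split.
- rewrite cisD (cisD theta0 pi) (cis_double_atan (xy t Ut) (x1 t Ut)).
  have -> : cis pi = -1 :> R[i].
    by rewrite /cis cospi sinpi; apply/eqP; rewrite eq_complex /= oppr0 !eqxx.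
  rewrite mulrN1 mulNr uE -mulrN; congr (_ * _).
  by apply/eqP; rewrite eq_complex /= !opprK !eqxx.
- have := atan_gtNpi2 (- y t / (1 - x t)); have := atan_ltpi2 (- y t / (1 - x t)).
  by move: (atan _) => A; rewrite ltr_pdivlMr // => h1 h2; lra.
- have [[d1 d2] _] := dz t Ut.
  have [e1 e2] := cderivM (conj d1 d2) (cderiv_cst (cis theta0)^* t).
  have dx : derivable x t 1 by exact: ex_derive.
  have dy : derivable y t 1 by exact: ex_derive.
  have x10 : 1 - x t != 0 by rewrite subr_eq0 eq_sym x1.
  have dq : derivable (fun t => - y t / (1 - x t)) t 1.
    apply: derivableM; first exact: derivableN.
    apply: derivableV => //; apply: derivableB => //.
  have i1 := @is_derive1_comp _ atan (fun t => - y t / (1 - x t)) t _ _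
    (is_derive1_atan _) (DeriveDef dq erefl).
  have d3 : derivable (fun t => atan (- y t / (1 - x t))) t 1 by exact: ex_derive.
  by apply: derivableD => //; apply: derivableM.
Qed.

End Cis.

Lemma Rintegral_gt0 d (T : measurableType d) (R : realType)
  (mu : {measure set T -> \bar R}) (D : set T) (h : T -> R) :
  measurable D -> mu.-integrable D (EFin \o h) -> (forall x, D x -> 0 <= h x) ->
  ~ {ae mu, forall x, D x -> h x = 0} -> 0 < Rintegral mu D h.
Proof.
move=> mD ih h0 nae; rewrite lt_neqAle Rintegral_ge0 // andbT eq_sym.
apply/negP => /eqP I0; apply: nae.
have mh : measurable_fun D (EFin \o h) by have /integrableP[] := ih.
have : (\int[mu]_(x in D) `|(h x)%:E| = 0)%E.
  have -> : (\int[mu]_(x in D) `|(h x)%:E| = \int[mu]_(x in D) (h x)%:E)%E.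
    by apply: eq_integral => x; rewrite inE => Dx; rewrite gee0_abs // lee_fin h0.
  have fin := integrable_fin_num mD ih.
  by rewrite -(fineK fin) -/(Rintegral _ _ _) I0.
move/(ae_eq_integral_abs mu mD mh); apply: filterS => x hx Dx.
by have [] := hx Dx.
Qed.

(** * The sine kernel and its sign *)

Section Kernel.
Variable R : realType.
Implicit Types (theta phi : R) (T : {poly R[i]}).

(** With [phi] the argument of the moving zero and [T] the cofactor, this is [P] times the conjugate
    of ['X * T] on the circle, up to the constant factor [(- 4)%:C * cis ((theta0 + phi) / 2)]. *)
Definition sine_kernel (theta0 : R) phi T theta : R :=
  sin ((theta - theta0) / 2) * sin ((theta - phi) / 2) *
  (complex.Re T.[cis theta] ^+ 2 + complex.Im T.[cis theta] ^+ 2).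

Lemma bm_sin_half (c : R) : bm (fun theta => sin ((theta - c) / 2)).
Proof.
split; last by exists 1 => x; rewrite ler_norml sin_geN1 sin_le1.
apply: continuous_measurable_fun => x.
apply: (@continuous_comp _ _ _ (fun y => (y - c) / 2) sin).
  by apply: cvgM; [apply: cvgB; [exact: cvg_id|exact: cvg_cst]|exact: cvg_cst].
exact: continuous_sin.
Qed.

Lemma bm_sine_kernel (theta0 : R) phi T : bm (sine_kernel theta0 phi T).
Proof.
have [h1 h2] := cbm_horner T.
apply: bmM; first by apply: bmM; apply: bm_sin_half.
by apply: bmD; under [X in bm X]eq_fun do rewrite expr2; apply: bmM.
Qed.

Lemma ip_sine_kernel (e : (R -> R) -> R) (theta0 : R) phi T : fun_linear e ->
  ip e (('X - (cis theta0)%:P) * ('X - (cis phi)%:P) * T) ('X * T) =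
  (- 4)%:C * cis ((theta0 + phi) / 2) * (e (sine_kernel theta0 phi T))%:C.
Proof.
move=> le; have bk := bm_sine_kernel theta0 phi T.
have -> : (e (sine_kernel theta0 phi T))%:C =
    CE e (fun theta => (sine_kernel theta0 phi T theta)%:C).
  apply/eqP; rewrite eq_complex /CE /= eqxx /=; apply/eqP.
  have := le.2 0 _ (bm_cst 0); rewrite [RHS]mul0r => e0.
  by rewrite -[LHS]e0; congr e; apply: funext => x; rewrite mul0r.
rewrite -(CEZ le); last by split => //; apply: bm_cst.
apply: eq_CE => theta.
rewrite !(hornerM, hornerXsubC, hornerX) rmorphM /=.
have TT : T.[cis theta] * (T.[cis theta])^* =
    (complex.Re T.[cis theta] ^+ 2 + complex.Im T.[cis theta] ^+ 2)%:C.
  by rewrite add_Re2_Im2 normCK.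
transitivity ((cis theta - cis theta0) * (cis theta - cis phi) * (cis theta)^* *
  (T.[cis theta] * (T.[cis theta])^*)); first by ring.
by rewrite cis_kernel TT /sine_kernel !rmorphM /=; ring.
Qed.

(** Writing the chord on the right by [cisB], both sides carry the phase [cis h] squared; after
    cancelling it, imaginary parts are compared. *)
Lemma phase_velocity (l D N theta0 phi : R) :
  (0 +i* l) * cis phi * cis theta0 * D%:C =
  (cis theta0 - cis phi) * ((- 4)%:C * cis ((theta0 + phi) / 2) * N%:C) ->
  l * D = 8 * sin ((phi - theta0) / 2) * N.
Proof.
set h := (theta0 + phi) / 2; rewrite cisB -/h => E1.
have ch0 : cis h != 0 by rewrite -normr_eq0 norm_cis oner_eq0.
have E2 : cis phi * cis theta0 = cis h * cis h.
  by rewrite -!cisD; congr cis; rewrite /h; field.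
have : (0 +i* l) * D%:C = (0 +i* (2 * sin ((theta0 - phi) / 2))) * (- 4)%:C * N%:C.
  apply: (mulIf (mulf_neq0 ch0 ch0)); rewrite -E2.
  transitivity ((0 +i* l) * cis phi * cis theta0 * D%:C); first by ring.
  by rewrite E1 E2; ring.
move/(congr1 (@complex.Im R)); rewrite !ImM !ReM /= => E3.
have -> : l * D = 0 * 0 + l * D by ring.
rewrite E3 (_ : (phi - theta0) / 2 = - ((theta0 - phi) / 2)); last by field.
by rewrite sinN; ring.
Qed.

(** Factoring out [w theta] turns the bracket into a difference of values of the increasing quotient
    at [theta] and [phi], which has the sign of [sin ((theta - phi) / 2)]; the other sine is
    nonnegative. *)
Lemma sine_kernel_sign (theta0 : R) phi T theta (w d : R -> R) :
  period theta0 theta -> theta0 < phi < theta0 + 2 * pi ->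
  0 < w theta -> 0 < w phi ->
  {in `]theta0, theta0 + 2 * pi[ &,
     {homo (fun x => (w x)^-1 * d x) : x y / x < y}} ->
  let h := sine_kernel theta0 phi T theta * (d theta - (w phi)^-1 * d phi * w theta) in
  0 <= h /\ (h = 0 -> sine_kernel theta0 phi T theta = 0).
Proof.
move=> pt /andP[p1 p2] wt wp inc /=.
have pi0 : 0 < (pi : R) by exact: pi_gt0.
move: pt; rewrite /period /= in_itv /= => /andP[].
(* At the left endpoint, outside the interval where the quotient increases, the kernel itself
   vanishes. *)
rewrite le_eqVlt => /orP[/eqP <- _|t1 t2].
  by rewrite /sine_kernel subrr mul0r sin0 !mul0r; split.
have k1 : 0 < sin ((theta - theta0) / 2).
  by apply: sin_gt0_pi; apply/andP; split; lra.
rewrite /sine_kernel; set q := _ ^+ 2 + _ ^+ 2.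
have q0 : 0 <= q by rewrite addr_ge0 // sqr_ge0.
have tin : theta \in `]theta0, theta0 + 2 * pi[ by rewrite in_itv /= t1 t2.
have pin : phi \in `]theta0, theta0 + 2 * pi[ by rewrite in_itv /= p1 p2.
have dE : d theta - (w phi)^-1 * d phi * w theta =
    w theta * ((w theta)^-1 * d theta - (w phi)^-1 * d phi).
  by field; rewrite !gt_eqF.
rewrite dE; set g := (fun x => (w x)^-1 * d x); rewrite -/(g theta) -/(g phi).
have S : 0 < sin ((theta - phi) / 2) * (g theta - g phi) \/ theta = phi.
  have [tp|tp|->] := ltgtP theta phi; last by right.
  - left; rewrite nmulr_lgt0 ?subr_lt0 ?inc //.
    rewrite -oppr_gt0 -sinN; apply: sin_gt0_pi; apply/andP; split; first by lra.
    by lra.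
  - left; rewrite mulr_gt0 ?subr_gt0 ?inc //.
    by apply: sin_gt0_pi; apply/andP; split; lra.
case: S => [S|->]; last by rewrite !subrr mul0r sin0 !(mulr0, mul0r); split.
have -> : sin ((theta - theta0) / 2) * sin ((theta - phi) / 2) * q *
   (w theta * (g theta - g phi)) =
   (sin ((theta - theta0) / 2) * w theta *
     (sin ((theta - phi) / 2) * (g theta - g phi))) * q.
  by ring.
have pos : 0 < sin ((theta - theta0) / 2) * w theta *
    (sin ((theta - phi) / 2) * (g theta - g phi)) by exact: mulr_gt0 (mulr_gt0 k1 wt) S.
split; first by rewrite mulr_ge0 // ltW.
by move/eqP; rewrite mulf_eq0 gt_eqF //= => /eqP ->; rewrite mulr0.
Qed.

Lemma sin_half_gt0 (theta0 phi : R) : theta0 < phi < theta0 + 2 * pi ->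
  0 < sin ((phi - theta0) / 2).
Proof.
have pi0 : 0 < (pi : R) by exact: pi_gt0.
by move=> /andP[p1 p2]; apply: sin_gt0_pi; apply/andP; split; lra.
Qed.

End Kernel.

(** * The derivative functional and its positivity *)

(** Removing the null set turns almost-everywhere hypotheses into pointwise ones on a measurable set
    of full measure. *)
Lemma ae_measurable_subset d (T : measurableType d) (R : realType)
  (mu : {measure set T -> \bar R}) (D : set T) (K : T -> Prop) :
  measurable D -> {ae mu, forall x, D x -> K x} ->
  exists D0, [/\ measurable D0, D0 `<=` D, mu (D `\` D0) = 0%E &
                 forall x, D0 x -> K x].
Proof.
move=> mD [N [mN N0 sN]]; exists (D `\` N); split.
- exact: measurableD.
- by move=> x [].
- apply/eqP; rewrite -measure_le0 -N0; apply: le_measure; rewrite ?inE //.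
    by apply: measurableD => //; exact: measurableD.
  by move=> x [Dx nx]; apply: contrapT => Nx; apply: nx.
- move=> x [Dx nNx]; apply: contrapT => nK; apply: nNx; apply: sN => /= h.
  exact: nK (h Dx).
Qed.

Section DensityFunctionals.
Context {R : realType} {D D0 J : set R} {mu : {measure set R -> \bar R}}.
Context {omega : R -> R -> \bar R} {mut : R -> {finite_measure set R -> \bar R}}.
Context {alpha : R -> R}.
Hypotheses (mD : measurable D) (mD0 : measurable D0) (D0D : D0 `<=` D).
Hypotheses (D00 : mu (D `\` D0) = 0%E) (oJ : open J).
Hypothesis dens : forall t, J t -> has_density D (mut t) mu (omega^~ t).
Hypothesis reg : forall theta t, D0 theta -> J t ->
  omega theta t \is a fin_num /\ derivable_t omega theta t.
Hypothesis alpha_int : mu.-integrable D (EFin \o alpha).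
Hypothesis dom : forall theta t, D0 theta -> J t -> `|d_t omega theta t| <= alpha theta.

Definition d_functional (t : R) (f : R -> R) : R :=
  Rintegral mu D0 (fun theta => f theta * d_t omega theta t).

Let int_d t f : J t -> bm f ->
  mu.-integrable D0 (EFin \o (fun theta => f theta * d_t omega theta t)).
Proof.
move=> Jt [mf [C fC]].
exact: (integrable_d_t mD mD0 D0D oJ dens reg alpha_int dom fC mf Jt).
Qed.

Lemma d_functional_linear t : J t -> fun_linear (d_functional t).
Proof.
move=> Jt; split=> [f g bf bg|c f bf]; rewrite /d_functional.
- rewrite -RintegralD //; [|exact: int_d|exact: int_d].
  by apply: eq_Rintegral => x _; rewrite mulrDl.
- rewrite -RintegralZl //; last exact: int_d.
  by apply: eq_Rintegral => x _; rewrite mulrA.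
Qed.

Lemma d_functional_derive (U : set R) : open U -> U `<=` J ->
  (forall theta s, D0 theta -> U s -> {for s, continuous (d_t omega theta)}) ->
  forall t f, U t -> bm f ->
  is_derive t 1 (fun s => Rintegral (mut s) setT f) (d_functional t f) /\
  {for t, continuous (fun s => d_functional s f)}.
Proof.
move=> oU UJ dc t f Ut [mf [C fC]]; split.
  exact: (is_derive_Rintegral_mut mD mD0 D0D D00 oJ dens reg alpha_int dom
    fC mf (UJ t Ut)).
exact: (continuous_Rintegral_d_t mD mD0 D0D oJ dens reg alpha_int dom
  fC mf oU UJ Ut dc).
Qed.

                                                                             
                                                                        
(** Since [f] integrates to zero against [mut t], subtracting [c] times the density from its
    derivative leaves the value unchanged; [c] can then be chosen to make the integrand
    nonnegative. *)
Lemma d_functional_gt0 t (f : R -> R) (c : R) : J t -> bm f ->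
  Rintegral (mut t) setT f = 0 ->
  (forall theta, D0 theta ->
     let h := f theta * (d_t omega theta t - c * fine (omega theta t)) in
     0 <= h /\ (h = 0 -> f theta = 0)) ->
  ~ {ae mu, forall theta, D0 theta -> f theta = 0} ->
  0 < d_functional t f.
Proof.
move=> Jt bf f0 hP nae; have [mf [C fC]] := bf.
have i1 := int_d Jt bf.
have i2 : mu.-integrable D0 (EFin \o (fun x => f x * fine (omega x t))).
  have bf' : [bounded f x | x in D0].
    by exists C; split; rewrite ?num_real // => y Cy x _; apply: le_trans (ltW Cy).
  have iw := integrable_weight mD mD0 D0D D00 dens reg Jt.
  exact: (integrableMr mD0 (measurable_funTS mf) bf' iw).
have i3 : mu.-integrable D0 (EFin \o (fun x => c * (f x * fine (omega x t)))).
  exact: (integrableZl mD0 c i2).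
pose h x := f x * d_t omega x t - c * (f x * fine (omega x t)).
have hE x : h x = f x * (d_t omega x t - c * fine (omega x t)) by rewrite /h; ring.
have -> : d_functional t f = Rintegral mu D0 h.
  rewrite RintegralB // RintegralZl //.
  have := Rintegral_mut mD mD0 D0D D00 dens reg fC mf Jt.
  by rewrite f0 => <-; rewrite mulr0 subr0.
apply: Rintegral_gt0 => //.
- exact: (integrableB mD0 i1 i3).
- by move=> x Dx; rewrite hE; have [] := hP x Dx.
- move=> h0; apply: nae; apply: filterS h0 => x hx Dx.
  by have [_] := hP x Dx; apply; rewrite -hE hx.
Qed.

Lemma Rintegral_mut_ae0 t (f : R -> R) : J t -> bm f ->
  {ae mu, forall theta, D0 theta -> f theta = 0} -> Rintegral (mut t) setT f = 0.
Proof.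
move=> Jt [mf [C fC]] fae.
rewrite (Rintegral_mut mD mD0 D0D D00 dens reg fC mf Jt).
rewrite (ae_eq_Rintegral (g := fun=> 0) mD0).
- rewrite /Rintegral integral0 //.
- apply: measurable_funM; first exact: measurable_funTS.
  have [mo _ _] := dens Jt; apply: measurableT_comp => //.
  exact: measurable_funS mo.
- exact: measurable_cst.
- by apply: filterS fae => x fx Dx; rewrite fx // mul0r.
Qed.

End DensityFunctionals.

(** * Strict monotonicity of the argument, and the theorem *)

Lemma zero_counterclockwise (R : realType) (theta0 t0 eps : R) (D0 J : set R)
  (mu : {measure set R -> \bar R}) (omega : R -> R -> \bar R)
  (mut : R -> {finite_measure set R -> \bar R}) (alpha : R -> R)
  (m : nat) (b : R -> R[i]) (Q : R -> nat -> {poly R[i]}) (P : R -> {poly R[i]})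
  (zeta : R -> R[i]) :
  let D := period theta0 in let U := ball t0 eps in
  measurable D0 -> D0 `<=` D -> mu (D `\` D0) = 0%E ->
  open J -> U `<=` J ->
  (forall t, J t -> has_density D (mut t) mu (omega^~ t)) ->
  (forall theta t, D0 theta -> J t ->
     omega theta t \is a fin_num /\ derivable_t omega theta t) ->
  mu.-integrable D (EFin \o alpha) ->
  (forall theta t, D0 theta -> J t -> `|d_t omega theta t| <= alpha theta) ->
  (forall theta s, D0 theta -> U s -> {for s, continuous (d_t omega theta)}) ->
  (forall t, J t -> [/\ `|b t| = 1, opuc (mut t) (Q t) &
     P t = 'X * Q t m - ((b t)^*)%:P * revpoly m (Q t m)]) ->
  cC1 U zeta ->
  (forall t, U t -> root (P t) (zeta t)) ->
  (forall t, U t -> root (P t) (cis theta0)) ->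
  (forall t, U t -> zeta t != cis theta0) ->
  (forall theta t, D theta -> U t -> 0 < fine (omega theta t)) ->
  (forall t, U t -> {in `]theta0, theta0 + 2 * pi[ &,
     {homo (fun theta => (fine (omega theta t))^-1 * d_t omega theta t) :
            x y / x < y}}) ->
  strictly_counterclockwise U zeta.
Proof.
move=> D U mD0 D0D D00 oJ UJ dens reg ia dom dc hP cz rz ra za w0 inc.
have mD : measurable D by exact: measurable_itv.
have oU : open U by exact: ball_open.
pose E t f := Rintegral (mut t) setT f.
pose dE := @d_functional R D0 mu omega.
have linE t : U t -> fun_linear (E t) by move=> _; exact: Rintegral_fun_linear.
have lindE t : U t -> fun_linear (dE t).
  by move=> /UJ; exact: (d_functional_linear mD mD0 D0D oJ dens reg ia dom).
have derE := d_functional_derive mD mD0 D0D D00 oJ dens reg ia dom oU UJ dc.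
have E0 t f : bm f -> (forall x, 0 <= f x) -> 0 <= E t f.
  by move=> _ f0; apply: Rintegral_ge0.
have Qm t : U t -> forall n, Q t n \is monic /\ size (Q t n) = n.+1.
  by move=> /UJ /hP [_ /opuc_ip[]].
have Qo t : U t -> forall i j, i != j -> ip (E t) (Q t i) (Q t j) = 0.
  by move=> /UJ /hP [_ /opuc_ip[]].
have Q0 t : U t -> forall n, ip (E t) (Q t n) (Q t n) != 0.
  by move=> /UJ /hP [_ /opuc_ip[]].
have P_def t : U t -> P t = 'X * Q t m - ((b t)^*)%:P * revpoly m (Q t m).
  by move=> /UJ /hP [].
have b1 t : U t -> `|b t| = 1 by move=> /UJ /hP [].
pose a := cis theta0; have a1 : `|a| = 1 by exact: norm_cis.
(* The regularity of [b] is extracted from the permanent zero at [cis theta0]. *)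
have cb : cC1 U b.
  apply: (cC1_popuc_parameter oU linE derE Qm Qo Q0 a1 (m := m)) => t Ut.
  by rewrite -P_def // ra.
have cP : cC1_poly U P.
  move=> k; apply: (eq_cC1 oU _ (cC1_popuc oU linE derE Qm Qo Q0 m cb k)) => t Ut.
  by rewrite P_def.
have zn t : U t -> `|zeta t| = 1.
  by move=> Ut; exact: (zeta_norm1 linE Qm Qo Q0 P_def rz (E0 t) (b1 t Ut) Ut).
have [phi phiP] := cis_lift cz zn za.
have phi_pos s : U s -> 0 < 'D_1 phi s.
  move=> Us; have [zE phi_in dphi] := phiP s Us.
  set l := 'D_1 phi s.
  have dz : cderiv zeta s ((0 +i* l) * cis (phi s)).
    have := cderiv_cis (DeriveDef dphi erefl); apply: eq_cderiv.
    by apply: filterS (open_nbhs_nbhs (conj oU Us)) => t /phiP [-> _ _].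
  pose T := cofactor_poly P a zeta s.
  have PT : P s = ('X - a%:P) * ('X - (zeta s)%:P) * T.
    by rewrite -mulrA; exact: (popuc_factor ra rz za Us).
  have PT0 : T != 0.
    apply/eqP => T0; have := popuc_size (Qm s Us) m (b s).
    by rewrite -P_def // PT T0 mulr0 size_poly0.
  have sT : (size T <= m)%N.
    by rewrite (size_cofactor Qm P_def ra rz za Us).
  have := zero_velocity_norm oU linE lindE derE Qm Qo Q0 P_def cP a1 ra rz za cz Us
    (zn s Us) dz.
  rewrite -/T zE -/a.
  have := ip_gt0 (linE s Us) (E0 s) (Qm s Us) (Qo s Us) (Q0 s Us)
    (mulf_neq0 (negbT (polyXsubC_eq0 a)) PT0).
  set N := ip _ _ _ => N0.
  have NE : N = (complex.Re N)%:C by rewrite RRe_real // gtr0_real.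
  have N1 : 0 < complex.Re N by rewrite -ltcR -NE.
  rewrite {1}NE (ip_sine_kernel theta0 (phi s) T (lindE s Us)) => /phase_velocity.
  set f := sine_kernel _ _ _ => lE.
  have bf : bm f by exact: bm_sine_kernel.
  (* Orthogonality of [P s] to ['X * T], divided by the nonzero constant relating that pairing to
     the kernel. *)
  have Ef : E s f = 0.
    have := popuc_orth (linE s Us) (Qm s Us) (Qo s Us) (Q0 s Us) (b s) sT.
    rewrite -P_def // PT zE (ip_sine_kernel theta0 (phi s) T (linE s Us)) => /eqP.
    rewrite !mulf_eq0 -/f => /orP[/orP[]|].
    - by rewrite eq_complex /= oppr_eq0 pnatr_eq0.
    - by rewrite -normr_eq0 norm_cis oner_eq0.
    - by rewrite eq_complex /= => /andP[/eqP].
  have wphi : 0 < fine (omega (phi s) s).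
    by apply: w0 => //; rewrite /D /period /= in_itv /=; case/andP: phi_in => /ltW -> ->.
  (* The constant [c] is the logarithmic derivative of the density at the zero itself, so that the
     bracket changes sign where the kernel does, at [phi s]. *)
  have dEf : 0 < dE s f.
    apply: (d_functional_gt0 mD mD0 D0D D00 oJ dens reg ia dom
      (c := (fine (omega (phi s) s))^-1 * d_t omega (phi s) s) (UJ s Us) bf Ef).
      move=> theta /D0D Dt.
      exact: (sine_kernel_sign T (w := fun x => fine (omega x s))
        (d := fun x => d_t omega x s) Dt phi_in (w0 _ _ Dt Us) wphi (inc s Us)).
    (* Wherever the kernel vanishes, so does [P s]; if it vanished almost everywhere, [P s] would be
       a nonzero polynomial of norm zero. *)
    move=> f_ae; have P0 : P s != 0.
      by rewrite PT !mulf_neq0 // polyXsubC_eq0.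
    have := ip_gt0 (linE s Us) (E0 s) (Qm s Us) (Qo s Us) (Q0 s Us) P0.
    have Pz theta : f theta = 0 -> (P s).[cis theta] = 0.
      move=> /eqP; rewrite PT !hornerM !hornerXsubC zE mulf_eq0 => /orP[/eqP k0|q0].
        have := cis_kernel theta theta0 (phi s); rewrite k0 mulr0 mul0r.
        move=> /eqP; rewrite mulf_eq0 conjC_eq0 -[cis theta == 0]normr_eq0 norm_cis.
        by rewrite oner_eq0 orbF => /eqP; rewrite -/a => ->; rewrite mul0r.
      have -> : T.[cis theta] = 0; last by rewrite mulr0.
      by apply/eqP; rewrite -[_ == _]negbK -normsq_neq0 q0.
    have [b2 b3] := cbm_prod (P s) (P s).
    rewrite lt0r => /andP[/eqP[]].
    apply/eqP; rewrite eq_complex /ip /CE /=; apply/andP; split; apply/eqP.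
    - apply: (Rintegral_mut_ae0 mD mD0 D0D D00 dens reg (UJ s Us) b2).
      by apply: filterS f_ae => theta h Dt; rewrite Pz ?h // mul0r.
    - apply: (Rintegral_mut_ae0 mD mD0 D0D D00 dens reg (UJ s Us) b3).
      by apply: filterS f_ae => theta h Dt; rewrite Pz ?h // mul0r.
  rewrite -(pmulr_lgt0 _ N1) lE; apply: mulr_gt0 => //; apply: mulr_gt0 => //.
  exact: sin_half_gt0.
have inU t : U t <-> t \in `]t0 - eps, t0 + eps[.
  by rewrite /U ball_itv /=.
have phic t : U t -> {for t, continuous phi}.
  move=> /phiP [_ _ d]; apply: differentiable_continuous.
  exact/derivable1_diffP.
exists phi; split.
- by apply: continuous_in_subspaceT => t; rewrite inE => /phic.
- by move=> t /phiP [].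
- move=> s t Us Ut st.
  have := @gtr0_derive1_lt_oo R phi (t0 - eps) (t0 + eps) _ _ _ s t.
  apply => //; try exact/inU.
  + by move=> x /inU /phiP [].
  + by move=> x /inU /phi_pos; rewrite derive1E.
  + by move=> x; rewrite inE => /inU /phic.
Qed.

Theorem theorem3p1 (R : realType) (theta0 t0 : R) (J : set R)
  (mu : {measure set R -> \bar R})
  (omega : R -> R -> \bar R)
  (mut : R -> {finite_measure set R -> \bar R})
  (alpha : R -> R)
  (n : nat) (b : R -> R[i]) (P : R -> {poly R[i]}) (zeta0 : R[i])
  (J_open : open J) (J_itv : is_interval J) (J_t0 : J t0)
  (mut_density : forall t, J t ->
     has_density (period theta0) (mut t) mu (omega^~ t))
  (mut_support : forall t, J t -> infinite_set (circle_support (mut t)))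
  (omega_derivable : {ae mu, forall theta, period theta0 theta ->
     forall t, J t -> omega theta t \is a fin_num /\ derivable_t omega theta t})
  (alpha_integrable : mu.-integrable (period theta0) (EFin \o alpha))
  (omega_dominated : {ae mu, forall theta, period theta0 theta ->
     forall t, J t -> `|d_t omega theta t| <= alpha theta})
  (n_gt0 : (0 < n)%N)
  (P_popuc : forall t, J t -> popuc (mut t) n (b t) (P t))
  (P_zeta0 : root (P t0) zeta0) :
  (C1c_on J b ->
   {ae mu, forall theta, period theta0 theta ->
      forall t, J t -> {for t, continuous (d_t omega theta)}} ->
   exists eps delta zeta, zero_branch P J zeta0 t0 eps delta zeta) /\
  (forall (eps delta : R) (zeta : R -> R[i]),
   zero_branch P J zeta0 t0 eps delta zeta ->
   (forall t, ball t0 eps t -> root (P t) (cis theta0)) ->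
   zeta0 != cis theta0 ->
   (forall theta t, period theta0 theta -> ball t0 eps t ->
      (0 < omega theta t < +oo)%E) ->
   {within period theta0 `*` ball t0 eps,
      continuous (fun p : R * R => omega p.1 p.2)} ->
   (forall theta t, period theta0 theta -> ball t0 eps t ->
      derivable_t omega theta t) ->
   {within period theta0 `*` ball t0 eps,
      continuous (fun p : R * R => d_t omega p.1 p.2)} ->
   (forall t, ball t0 eps t ->
      {in `]theta0, theta0 + 2 * pi[ &,
         {homo (fun theta => (fine (omega theta t))^-1 * d_t omega theta t) :
            x y / x < y}}) ->
   strictly_counterclockwise (ball t0 eps) zeta).
Proof.
case: n n_gt0 P_popuc => // m _ P_popuc.
have mD : measurable (period theta0) by exact: measurable_itv.
have /choice [Q QP] : forall t, exists Qt : nat -> {poly R[i]}, J t ->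
    [/\ `|b t| = 1, opuc (mut t) Qt &
     P t = 'X * Qt m - ((b t)^*)%:P * revpoly m (Qt m)].
  (* Choice needs a sequence for every real [t]; off [J] the zero sequence is a dummy value. *)
  move=> t; have [Jt|nJt] := pselect (J t); last by exists (fun=> 0).
  by have [bt [Qt oQ PE]] := P_popuc t Jt; exists Qt.
pose E t f := Rintegral (mut t) setT f.
have linE t : fun_linear (E t) by exact: Rintegral_fun_linear.
have E0 t f : bm f -> (forall x, 0 <= f x) -> 0 <= E t f.
  by move=> _ f0; apply: Rintegral_ge0.
have Qm t : J t -> forall k, Q t k \is monic /\ size (Q t k) = k.+1.
  by move=> /QP [_ /opuc_ip[]].
have Qo t : J t -> forall i j, i != j -> ip (E t) (Q t i) (Q t j) = 0.
  by move=> /QP [_ /opuc_ip[]].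
have Q0 t : J t -> forall k, ip (E t) (Q t k) (Q t k) != 0.
  by move=> /QP [_ /opuc_ip[]].
have b1 t : J t -> `|b t| = 1 by move=> /QP [].
have PE t : J t -> P t = 'X * Q t m - ((b t)^*)%:P * revpoly m (Q t m).
  by move=> /QP [].
have P_circle t z : J t -> root (P t) z -> `|z| = 1.
  move=> Jt; rewrite PE //.
  exact: (popuc_root_circle (linE t) (E0 t) (Qm t Jt) (Qo t Jt) (Q0 t Jt)
    (b1 t Jt)).
have reg : {ae mu, forall theta, period theta0 theta -> forall t, J t ->
    [/\ omega theta t \is a fin_num, derivable_t omega theta t &
        `|d_t omega theta t| <= alpha theta]}.
  apply: filterS2 omega_derivable omega_dominated => theta h1 h2 Dt t Jt.
  by have [? ?] := h1 Dt t Jt; split => //; exact: h2.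
split.
- move=> /(C1c_onP _ J_open) cb cont.
  have : {ae mu, forall theta, period theta0 theta -> forall t, J t ->
    [/\ omega theta t \is a fin_num, derivable_t omega theta t,
        `|d_t omega theta t| <= alpha theta &
        {for t, continuous (d_t omega theta)}]}.
    apply: filterS2 reg cont => theta h1 h2 Dt t Jt.
    by have [? ? ?] := h1 Dt t Jt; split => //; exact: h2.
  move=> /(ae_measurable_subset mD) [D0 [mD0 D0D D00 K]].
  have reg' theta t : D0 theta -> J t ->
    omega theta t \is a fin_num /\ derivable_t omega theta t.
    by move=> Dt Jt; have [? ? _ _] := K theta Dt t Jt.
  have dom theta t : D0 theta -> J t -> `|d_t omega theta t| <= alpha theta.
    by move=> Dt Jt; have [] := K theta Dt t Jt.
  have dc theta t : D0 theta -> J t -> {for t, continuous (d_t omega theta)}.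
    by move=> Dt Jt; have [] := K theta Dt t Jt.
  have derE := d_functional_derive mD mD0 D0D D00 J_open mut_density reg'
    alpha_integrable dom J_open (fun x => id) dc.
  apply: (exists_zero_branch (n := m) J_open) => //.
  + move=> k; apply: (eq_cC1 J_open _ (cC1_popuc J_open (fun t _ => linE t)
      derE Qm Qo Q0 m cb k)) => t Jt.
    by rewrite PE.
  + move=> t Jt; have [mQ sQ] := Qm t Jt m.
    have sP := popuc_size (Qm t Jt) m (b t).
    rewrite monicE lead_coefE PE // sP coefB coefXM /= mul_polyC coefZ.
    rewrite [(revpoly _ _)`__]nth_default ?size_poly // mulr0 subr0.
    by have := mQ; rewrite monicE lead_coefE sQ.
  + by move=> t Jt; rewrite PE // (popuc_size (Qm t Jt)).
  + move=> t z Jt; rewrite PE //.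
    exact: (popuc_root_simple (linE t) (E0 t) (Qm t Jt) (Qo t Jt) (Q0 t Jt)
    (b1 t Jt)).
- move=> eps delta zeta [e0 d0 UJ branch C1z] ra zeta0a w0 _ _ dcont inc.
  have [D0 [mD0 D0D D00 K]] := ae_measurable_subset mD reg.
  have oU : open (ball t0 eps) by exact: ball_open.
  have dc theta s : D0 theta -> ball t0 eps s -> {for s, continuous (d_t omega theta)}.
    move=> /D0D Dt Us.
    (* Joint continuity on the product is restricted to the slice at [theta]; the ball being open,
       the subspace restriction disappears near [s]. *)
    move/subspace_continuousP : dcont => /(_ (theta, s) (conj Dt Us)) c.
    apply: (cvg_comp (fun s' => (theta, s')) _ _ c) => A /= [[B1 B2] /= [nB1 nB2] BA].
    have nU := open_nbhs_nbhs (conj oU Us).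
    apply: filterS2 nU nB2 => s' Us' B2s'; apply: BA => //=; split => //.
    exact: nbhs_singleton.
  apply: (zero_counterclockwise mD0 D0D D00 J_open UJ mut_density _ alpha_integrable
    _ dc QP) => //.
  + by move=> theta t Dt Jt; have [] := K theta Dt t Jt.
  + by move=> theta t Dt Jt; have [] := K theta Dt t Jt.
  + exact/(C1c_onP _ oU).
  + by move=> t /branch [].
  + have Ut0 : ball t0 eps t0 by exact: ballxx.
    have z0c : circ zeta0 delta zeta0.
      by split; [exact: P_circle P_zeta0|rewrite subrr normr0 ltcR].
    have z0E : zeta0 = zeta t0 by have [_ _ u] := branch t0 Ut0; exact: u.
    (* If the branch met [cis theta0] at some [t], that point would lie in the disc about [zeta0];
       being a zero of [P t0] too, it would equal [zeta0] by uniqueness at [t0]. *)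
    move=> t Ut; apply: contra_neq zeta0a => zta.
    have [ct _ _] := branch t Ut; have [_ _ u] := branch t0 Ut0.
    rewrite z0E; apply/esym; apply: u; last exact: ra.
    by rewrite -zta.
  + by move=> theta t Dt Ut; apply: fine_gt0; exact: w0.
Qed.
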